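(* Let $\{w_i\}_{i=1}^n$ be a basis of $\mathbb{R}^n$ and let $(S_1,\dots,S_m)$ be a uniform cover of $[n]$ with weights $(p_1,\dots,p_m)$. Let $H_j=\mathrm{span}\{w_k : k\in S_j\}$, $\widetilde{H}_j=\mathrm{span}\{w_k : k\notin S_j\}$ and $p=\sum_{j=1}^m p_j$. Put $$BL_1:=\frac{\prod_{j=1}^m|\wedge_{k\in[n]\setminus S_j}w_k|^{p_j}}{|\wedge_{i=1}^n w_i|^{p-1}},\qquad BL_2:=\frac{\prod_{j=1}^m|\wedge_{k\in S_j}w_k|^{p_j}}{|\wedge_{i=1}^n w_i|}.$$ Then for every compact $K\subseteq\mathbb{R}^n$ the following four inequalities hold: $$|K|\leqslant BL_1\prod_{j=1}^m|P_{\widetilde{H}_j^\perp}K|^{p_j},\qquad |K|^{p-1}\leqslant BL_2\prod_{j=1}^m|P_{H_j^\perp}K|^{p_j},$$ $$|K|\leqslant BL_2\prod_{j=1}^m|P_{H_j}K|^{p_j},\qquad |K|^{p-1}\leqslant BL_1\prod_{j=1}^m|P_{\widetilde{H}_j}K|^{p_j}.$$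
   Context: $[n]=\{1,\dots,n\}$. For $m\geqslant1$, subsets $S_1,\dots,S_m\subseteq[n]$ (not necessarily distinct) form a uniform cover of $[n]$ with weights $(p_1,\dots,p_m)$, $p_j>0$ for all $j$, if $\sum_{j=1}^m p_j\chi_{S_j}(i)=1$ for every $i\in[n]$. For vectors $u_1,\dots,u_k$, $|\wedge_{i=1}^k u_i|$ is the $k$-dimensional volume of the parallelepiped they span (equal to $1$ for the empty family). $P_F$ is the orthogonal projection onto the linear subspace $F$ of $\mathbb{R}^n$, $F^\perp$ its orthogonal complement, and $|\cdot|$ of a set denotes Lebesgue measure in the corresponding subspace (unit point mass on $\{0\}$).
   Formalization: The second and fourth inequalities are stated except when K is empty and p = 1, where the left side is 0^0 (read as 1) and the right side is 0. *)

(* Defs.v *)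
From mathcomp Require Import all_boot all_order all_algebra.
From mathcomp Require Import sesquilinear.
From mathcomp Require Import all_classical all_reals all_analysis.

Set Implicit Arguments.
Unset Strict Implicit.
Unset Printing Implicit Defensive.

Import Order.TTheory GRing.Theory Num.Theory.
Import numFieldNormedType.Exports.

Local Open Scope classical_set_scope.
Local Open Scope ring_scope.

(* Vectors of R^n are row vectors with the standard inner product u *m v^T;   *)
(* a linear subspace is, as in mxalgebra, the row space of a matrix.          *)

Section lebesgue_Rn.
Context {R : realType}.

(* The n-fold product of the one-dimensional Lebesgue measure; for n = 0 it   *)
(* is the unit mass at the only point.                                        *)
Fixpoint lebesgue_tuple (n : nat) : set (n.-tuple R) -> \bar R :=
  if n is k.+1 then
    pushforward (@lebesgue_measure R \x @lebesgue_tuple k)%E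
      (fun z : R * k.-tuple R => cons_tuple z.1 z.2)
  else @dirac _ _ [tuple] R.

Definition lebesgue_rV n (A : set 'rV[R]_n) : \bar R :=
  lebesgue_tuple [set t : n.-tuple R | A (\row_i tnth t i)].

Local Open Scope ereal_scope.

Lemma lebesgue_tuple_box n (a b : 'I_n -> R) : (forall i, (a i <= b i)%R) ->
  lebesgue_tuple [set t : n.-tuple R | forall i, (a i <= tnth t i <= b i)%R]
  = \prod_(i < n) (b i - a i)%:E.
Proof.
elim: n a b => [|n IH] a b ab.
  rewrite big_ord0 /= /dirac indicE mem_set// => -[]//.
rewrite /= /pushforward /product_measure1 big_ord_recl/=.
pose c : R := (\prod_(i < n) (b (lift ord0 i) - a (lift ord0 i)))%R.
have cE : \prod_(i < n) (b (lift ord0 i) - a (lift ord0 i))%:E = c%:E.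
  by rewrite /c prodEFin.
rewrite cE (_ : (fun x => _) = fun x => c%:E * (\1_(`[a ord0, b ord0]) x)%:E).
  rewrite integralZl//=; last first.
    exact: integrable_indic_itv.
  rewrite integral_indic// setIT muleC; congr (_ * _).
  rewrite [LHS](lebesgue_measure_itv `[a ord0, b ord0])/= lte_fin.
  have := ab ord0; rewrite le_eqVlt => /predU1P[->|->]; last by rewrite EFinB.
  by rewrite ltxx subrr.
have m0 k : lebesgue_tuple (set0 : set (k.-tuple R)) = 0.
  elim: k => [|k IHk]; first by rewrite /= /dirac indicE in_set0.
  rewrite /= /pushforward /product_measure1 preimage_set0.
  by apply: integral0_eq => x _ /=; rewrite xsection0.
apply/funext => x /=; rewrite indicE mem_setE in_itv/=.
have [xab|xab] := boolP (_ <= x <= _)%R.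
  rewrite mule1 -cE -IH//; congr lebesgue_tuple.
  apply/seteqP; split => t /=; rewrite /xsection /= inE/=.
    by move=> h i; have := h (lift ord0 i); rewrite !(tnth_nth 0%R)/=.
  move=> h i; case: (unliftP ord0 i) => [j ->|->].
    by have := h j; rewrite !(tnth_nth 0%R)/=.
  by rewrite (tnth_nth 0%R).
rewrite mule0 (_ : xsection _ _ = set0) ?m0//.
apply/seteqP; split => // t; rewrite /xsection /= inE/= => /(_ ord0).
by rewrite (tnth_nth 0%R)/= (negbTE xab).
Qed.

End lebesgue_Rn.

Section subspaces.
Context {R : realType} {n : nat}.
Implicit Types (F : 'M[R]_n) (A : set 'rV[R]_n).

Definition orthocomp F : 'M[R]_n := orthomx idfun 1%:M F.

Lemma dot_gt0 (v : 'rV[R]_n) : v != 0 -> 0 < (v *m v^T) 0 0.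
Proof.
move=> v0; have E : (v *m v^T) 0 0 = \sum_i v 0 i ^+ 2.
  by rewrite mxE; apply: eq_bigr => i _; rewrite mxE expr2.
rewrite E lt_def sumr_ge0 ?andbT => [|i _]; last exact: sqr_ge0.
apply: contra v0 => /eqP s0; apply/eqP/rowP => i; rewrite mxE.
have /eqP := psumr_eq0P (fun i _ => sqr_ge0 (v 0 i)) s0 (i:=i) isT.
by rewrite sqrf_eq0 => /eqP.
Qed.

Lemma orthocomp_direct F :
  (F :&: orthocomp F = 0)%MS /\ (F + orthocomp F :=: 1%:M)%MS.
Proof.
have Eo : orthocomp F = kermx F^T.
  by rewrite /orthocomp /orthomx mul1mx map_mx_id.
have c : (F :&: orthocomp F = 0)%MS.
  apply/eqP/rowV0P => v; rewrite Eo sub_capmx => /andP[/submxP[x vx]].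
  move=> /sub_kermxP v0; apply/eqP/negPn/negP => /dot_gt0.
  by rewrite {2}vx trmx_mul mulmxA v0 mul0mx mxE ltxx.
split=> //; apply/eqmxP/andP; split; first exact: submx1.
rewrite sub1mx /row_full.
rewrite (mxrank_disjoint_sum c).
by rewrite Eo mxrank_ker mxrank_tr subnKC ?rank_leq_col.
Qed.

Definition orthoproj F (A : set 'rV[R]_n) : set 'rV[R]_n :=
  [set x *m proj_mx F (orthocomp F) | x in A].

Definition onb F : 'M[R]_(\rank F, n) :=
  xget 0 [set B : 'M[R]_(\rank F, n) | B *m B^T = 1%:M /\ (B == F)%MS].

Lemma onb_exists k F : \rank F = k ->
  exists B : 'M[R]_(k, n), B *m B^T = 1%:M /\ (B == F)%MS.
Proof.
elim: k F => [|k IH] F rF.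
  exists 0; split; first by apply/matrixP => -[].
  by move/eqP: rF; rewrite mxrank_eq0 => /eqP ->; rewrite !sub0mx.
have F0 : nz_row F != 0 by rewrite nz_row_eq0 -mxrank_eq0 rF.
have d0 := dot_gt0 F0; set v := nz_row F in F0 d0.
pose c := (v *m v^T) 0 0; pose u := (Num.sqrt c)^-1 *: v.
have uF : (u <= F)%MS by rewrite scalemx_sub// nz_row_sub.
have uu : u *m u^T = 1%:M.
  rewrite /u [(_ *: v)^T]linearZ/= -scalemxAl -scalemxAr scalerA.
  rewrite [v *m v^T]mx11_scalar -/c -invfM -expr2 sqr_sqrtr ?ltW//.
  by rewrite scale_scalar_mx mulVf ?gt_eqF.
have /IH[B [BB BE]] : \rank (F :&: kermx u^T)%MS = k.
  have := mxrank_mul_ker F u^T; rewrite rF.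
  suff -> : \rank (F *m u^T) = 1%N by move=> [].
  apply/eqP; rewrite eqn_leq rank_leq_col/= lt0n mxrank_eq0.
  have /submxP[x ux] := uF.
  apply/eqP => Fu0; have := uu; rewrite {1}ux -mulmxA Fu0 mulmx0.
  by move/matrixP/(_ 0 0)/eqP; rewrite !mxE/= eq_sym oner_eq0.
have /andP[/[!sub_capmx]/andP[BF /sub_kermxP Bu] _] := BE.
exists (col_mx u B).
have E : col_mx u B *m (col_mx u B)^T = 1%:M.
  rewrite tr_col_mx mul_col_row uu BB Bu.
  have -> : u *m B^T = 0 by rewrite -[LHS]trmxK trmx_mul trmxK Bu trmx0.
  by rewrite -scalar_mx_block.
split=> //.
have s : (col_mx u B <= F)%MS by rewrite col_mx_sub uF.
rewrite s/= -(geq_leqif (mxrank_leqif_sup s)) rF.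
suff -> : \rank (col_mx u B) = k.+1 by [].
by apply/eqP; apply/row_freeP; exists (col_mx u B)^T.
Qed.

Lemma onbP F : onb F *m (onb F)^T = 1%:M /\ (onb F == F)%MS.
Proof.
rewrite /onb; case: xgetP => //= no.
by case: (onb_exists (erefl (\rank F))) => B /no.
Qed.

(* Lebesgue measure of the subspace F, for A included in F: R^(\dim F) is     *)
(* carried isometrically onto F by the coordinates in an orthonormal basis.   *)
Definition subspace_measure F A : \bar R :=
  lebesgue_rV [set y : 'rV[R]_(\rank F) | A (y *m onb F)].

Definition spanmx (w : 'I_n -> 'rV[R]_n) (S : {set 'I_n}) : 'M[R]_n :=
  (\sum_(k in S) <<w k>>)%MS.

Definition parallelepiped (w : 'I_n -> 'rV[R]_n) (S : {set 'I_n}) :=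
  [set \sum_(k in S) t k *: w k | t in [set t : 'I_n -> R |
     forall k, 0 <= t k <= 1]].

(* The #|S|-dimensional volume of the parallelepiped spanned by the w k with  *)
(* k in S, which is 0 if these vectors are linearly dependent.                *)
Definition wedge_norm (w : 'I_n -> 'rV[R]_n) (S : {set 'I_n}) : R :=
  if \rank (spanmx w S) == #|S|
  then fine (subspace_measure (spanmx w S) (parallelepiped w S))
  else 0.

End subspaces.

Definition uniform_cover {R : realType} {n m : nat}
    (S : 'I_m -> {set 'I_n}) (p : 'I_m -> R) : Prop :=
  (forall j, 0 < p j) /\ (forall i, \sum_(j < m) p j * (i \in S j)%:R = 1).

Section BL_constants.
Context {R : realType} {n m : nat}.
Variables (w : 'I_n -> 'rV[R]_n) (S : 'I_m -> {set 'I_n}) (p : 'I_m -> R).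

Definition BL1 : R :=
  (\prod_(j < m) wedge_norm w (~: S j) `^ p j) /
  wedge_norm w [set: 'I_n] `^ (\sum_(j < m) p j - 1).

Definition BL2 : R :=
  (\prod_(j < m) wedge_norm w (S j) `^ p j) / wedge_norm w [set: 'I_n].

End BL_constants.

(* Main.v *)
Require Import Defs.
From HB Require Import structures.
From mathcomp Require Import all_boot all_order all_algebra.
From mathcomp Require Import all_classical all_reals all_analysis.
From mathcomp Require Import measurable_realfun sesquilinear perm.

Set Implicit Arguments.
Unset Strict Implicit.
Unset Printing Implicit Defensive.

Import Order.TTheory GRing.Theory Num.Theory.
Import numFieldNormedType.Exports.

Local Open Scope classical_set_scope.
Local Open Scope ring_scope.

(** Write [W] for the invertible matrix with rows [w k]. In coordinates adapted
    to the basis, all four inequalities become Finner's weighted form of the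
    Loomis-Whitney inequality for coordinate projections ([shearer]): if
    [sum_j p_j 1_(i in S_j) = 1] for every coordinate [i], then the volume of a
    compact set [L] is at most the product of the [|pi_(S_j) L|^p_j].

    That inequality is proved by induction on the dimension. Slice [L] at a
    value [t] of the first coordinate and apply the induction hypothesis to each
    slice. The projections that forget the first coordinate are bounded by those
    of [L], independently of [t]; the others are slices of the projections of
    [L], and their weights add up to 1, so integrating over [t] and applying
    Hoelder's inequality with several factors ([generalized_hoelder]) recombines
    them. If the weights covering each coordinate add up to [s] rather than 1,
    dividing all weights by [s] gives the same inequality for [|L|^s]
    ([shearer_degree]); the family of complements of a uniform cover of total
    weight [q] has [s = q - 1].

    Two linear images of [K] produce the constants.

    - [L = K W^T] lists the inner products with the [w k]. If [B] is an
      orthonormal basis of [H = span (w k : k in S)], the rows [w k], [k in S],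
      are [C B] with [|det C|] the volume of their parallelepiped, so
      [pi_S L = (K B^T) C^T] has volume [|det C| |P_H K|] while
      [|L| = |det W| |K|]. This is [affine_shearer_span], which gives the
      inequalities for [P_H].

    - [L = K W^-1] lists the coordinates in the basis [w]. Projecting onto the
      orthogonal complement of [span (w k : k notin S)] kills the coordinates
      outside [S], so the projection is [pi_S L] times a square matrix [A].
      A block triangular determinant ([det_block_split]) shows that
      [|det A|] times the volume of the parallelepiped on the [w k],
      [k notin S], is [|det W|]. This is [affine_shearer_orthocomp], which gives
      the inequalities for [P_(H^perp)].

    Each of the two is used with [T = S], [s = 1] and with [T] the complement of
    [S], [s = q - 1].

    The measure-theoretic input is that an invertible matrix scales Lebesgue
    measure on [R^n] by its absolute determinant ([scales_volume_unit]); it is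
    read off the iterated integral defining that measure, by elimination with
    shears. *)

(** * Lebesgue measure on tuples as a sigma-finite measure *)

(** Turns a measurability proof into a bundled measure, where the bare set
    function [pushforward mu f] would leave that proof to be inferred. *)
Lemma pushforward_measure d d' (T : measurableType d) (T' : measurableType d')
    (R : realType) (mu : {measure set T -> \bar R}) (f : T -> T') :
  measurable_fun setT f -> exists nu : {measure set T' -> \bar R},
    (nu : set T' -> \bar R) = pushforward mu f.
Proof.
move=> mf.
unshelve refine (ex_intro _ (pushforward mu f : {measure set _ -> \bar R}) _).
- exact: mf.
- by [].
Qed.

Section sigma_finite_pack.
Context {R : realType} d (T : measurableType d).
Variable mu : {measure set T -> \bar R}.
(** A copy of [mu] that carries the finiteness proof in its type, so that the
    bundled structure can be attached to it for a variable [mu]. *)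
Definition sigma_finite_pack of sigma_finite setT mu : set T -> \bar R := mu.
Variable sf : sigma_finite setT mu.
HB.instance Definition _ := Measure.on (sigma_finite_pack sf).
HB.instance Definition _ :=
  Measure_isSigmaFinite.Build _ _ _ (sigma_finite_pack sf) sf.
End sigma_finite_pack.

Section lebesgue_measure_Rn.
Context {R : realType}.
Implicit Types n : nat.

Definition tuple_row n (t : n.-tuple R) : 'rV[R]_n := \row_i tnth t i.
Definition row_tuple n (v : 'rV[R]_n) : n.-tuple R := [tuple v 0 i | i < n].

Lemma row_tupleK n : cancel (@row_tuple n) (@tuple_row n).
Proof. by move=> v; apply/rowP => i; rewrite mxE tnth_mktuple. Qed.

Lemma tuple_row_cons n (x : R) (t : n.-tuple R) :
  tuple_row (cons_tuple x t) = row_mx x%:M (tuple_row t) :> 'rV_(1 + n).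
Proof.
apply/rowP => i; rewrite !mxE; case: splitP => j ij.
  by rewrite (_ : i = ord0) ?ord1 ?mxE//; apply/val_inj; rewrite /= ij ord1.
rewrite mxE (_ : i = lift ord0 j); last exact/val_inj.
by rewrite (tnth_nth 0) (tnth_nth 0).
Qed.

Lemma measurable_tuple_box n (B : 'I_n -> set R) :
  (forall i, measurable (B i)) ->
  measurable [set t : n.-tuple R | forall i, B i (tnth t i)].
Proof.
move=> mB; rewrite (_ : [set _ | _] = \bigcap_(i in [set: 'I_n])
    (((fun t => tnth t i) : n.-tuple R -> R) @^-1` B i)); last first.
  by apply/seteqP; split => t /= h i; [move=> _|]; exact: h.
apply: fin_bigcap_measurable => // i _; rewrite -[X in measurable X]setTI.
exact: (measurable_tnth i).
Qed.

Lemma measurable_tuple_cube n (r : R) :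
  measurable [set t : n.-tuple R | forall i, - r <= tnth t i <= r].
Proof.
rewrite (_ : [set _ | _] =
    [set t | forall i, `[- r, r]%classic (tnth t i)]).
  apply: (measurable_tuple_box (B := fun=> `[- r, r]%classic)) => i.
  exact: measurable_itv.
by apply/seteqP; split => t /= h i; have := h i; rewrite /= in_itv.
Qed.

(** The cubes of half-side [k] exhaust the space and have finite measure. *)
Lemma lebesgue_tuple_sigma_finite n :
  sigma_finite setT (@lebesgue_tuple R n).
Proof.
exists (fun k => [set t : n.-tuple R | forall i, (- k%:R <= tnth t i <= k%:R)]).
  apply/seteqP; split => // t _.
  have [k hk] : exists k : nat, forall i, `|tnth t i| <= k%:R.
    exists (\sum_i (Num.truncn `|tnth t i|).+1)%N => i.
    rewrite (bigD1 i)//= natrD ltW// ltr_wpDr//.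
    by rewrite truncnS_gt.
  by exists k => // i; rewrite -ler_norml.
move=> k; split; first exact: measurable_tuple_cube.
rewrite lebesgue_tuple_box => [|i]; last first.
  by rewrite (@le_trans _ _ 0)// oppr_le0.
by rewrite prodEFin ltry.
Qed.

(** [lebesgue_tuple] is only a set function, given by recursion on products.
    Countable additivity, monotonicity and Tonelli's theorem for it are obtained
    by rewriting with this equality. *)
Lemma lebesgue_tuple_measure n :
  exists mu : {sigma_finite_measure set (n.-tuple R) -> \bar R},
    (mu : set _ -> \bar R) = @lebesgue_tuple R n.
Proof.
have sigma (k : nat) (mu : {measure set (k.-tuple R) -> \bar R}) :
    (mu : set _ -> \bar R) = @lebesgue_tuple R k ->
    exists nu : {sigma_finite_measure set (k.-tuple R) -> \bar R},
      (nu : set _ -> \bar R) = @lebesgue_tuple R k.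
  move=> muE; have sf : sigma_finite setT mu.
    by rewrite muE; exact: lebesgue_tuple_sigma_finite.
  by exists (sigma_finite_pack sf).
elim: n => [|n [mu muE]]; first exact: (sigma _ (@dirac _ _ [tuple] R)).
have mc : measurable_fun setT
    (fun z : measurableTypeR R * n.-tuple R =>
       cons_tuple (z.1 : R) z.2 : n.+1.-tuple R).
  exact: (@measurable_cons _ _ _ _ fst n snd).
have [mu' mu'E] := pushforward_measure (@lebesgue_measure R \x mu)%E mc.
apply: (sigma _ mu'); apply/funext => A.
by rewrite mu'E /= /pushforward -muE.
Qed.
End lebesgue_measure_Rn.

(** * Affine changes of variable on the line *)

Section affine_line.
Context {R : realType}.
Local Notation leb := (@lebesgue_measure R).

Lemma measurable_affine (a b : R) :
  measurable_fun setT ((fun x => a * x + b) : R -> measurableTypeR R).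
Proof. by apply: measurable_funD => //; exact: measurable_funM. Qed.

Lemma lebesgue_measure_affine (a b : R) (A : set R) : a != 0 -> measurable A ->
  (`|a|%:E * leb [set x | A (a * x + b)%R] = leb A)%E.
Proof.
move=> a0 mA; have k0 : 0 <= `|a| by [].
have mf := measurable_affine a b.
have [nu nuE] := pushforward_measure leb mf.
have -> : (`|a|%:E * leb [set x | A (a * x + b)%R])%E =
    mscale (NngNum k0) nu A by rewrite /mscale nuE.
apply/esym/lebesgue_measure_unique => // _ [[u v] uv <-].
rewrite /= /mscale nuE /pushforward/=.
have [a_gt0|] := ltP 0 a; last rewrite le_eqVlt (negbTE a0)/= => a_lt0.
  rewrite (_ : _ @^-1` _ = `](u - b) / a, (v - b) / a]%classic); last first.
    apply/seteqP; split => x /=; rewrite !in_itv/=;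
      by rewrite ltr_pdivrMr// ler_pdivlMr// ltrBlDr lerBrDr (mulrC x).
  rewrite !lebesgue_measure_itv/= !lte_fin ltr_pM2r ?invr_gt0// ltrD2r.
  case: ifP => _; last by rewrite mule0.
  rewrite -!EFinB -EFinM gtr0_norm//; congr _%:E.
  by rewrite -mulrBl mulrCA divff// mulr1 opprB addrA subrK.
rewrite (_ : _ @^-1` _ = `[(v - b) / a, (u - b) / a[%classic); last first.
  apply/seteqP; split => x /=; rewrite !in_itv/=;
    by rewrite ltr_ndivlMr// ler_ndivrMr// ltrBlDr lerBrDr (mulrC x) andbC.
rewrite !lebesgue_measure_itv/= !lte_fin ltr_nM2r ?invr_lt0// ltrD2r.
case: ifP => _; last by rewrite mule0.
rewrite -!EFinB -EFinM ltr0_norm//; congr _%:E.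
by rewrite -mulrBl mulrCA mulNr divff// mulrN1 !opprB addrA subrK.
Qed.

Lemma ge0_integral_affine (a b : R) (g : R -> \bar R) : a != 0 ->
  measurable_fun [set: R] g -> (forall x, 0 <= g x)%E ->
  (`|a|%:E * \int[leb]_x g (a * x + b)%R = \int[leb]_x g x)%E.
Proof.
move=> a0 mg g0; have k0 : 0 <= `|a| by [].
have mf := measurable_affine a b.
pose f : R -> measurableTypeR R := fun x => a * x + b.
have <- := @ge0_integral_pushforward _ _ (measurableTypeR R)
  (measurableTypeR R) R f mf leb setT g measurableT mg (fun x _ => g0 x).
rewrite -[`|a|]/((NngNum k0)%:num) -ge0_integral_mscale//.
apply: eq_measure_integral => A mA _ /=.
exact: lebesgue_measure_affine.
Qed.

End affine_line.

(** * Slicing sets of row vectors by the first coordinate *)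

Section row_vectors.
Context {R : realType}.
Implicit Types n k : nat.

(** Row vectors inherit their sigma-algebra from tuples. *)
Definition measurable_rV n (A : set 'rV[R]_n) : Prop :=
  measurable (@tuple_row R n @^-1` A).

Lemma lebesgue_rV_ge0 n (A : set 'rV[R]_n) : (0 <= lebesgue_rV A)%E.
Proof.
have [mu muE] := @lebesgue_tuple_measure R n.
by rewrite /lebesgue_rV -muE.
Qed.

Lemma le_lebesgue_rV n (A B : set 'rV[R]_n) :
  measurable_rV A -> measurable_rV B -> A `<=` B ->
  (lebesgue_rV A <= lebesgue_rV B)%E.
Proof.
move=> mA mB AB; have [mu muE] := @lebesgue_tuple_measure R n.
rewrite /lebesgue_rV -muE; apply: le_measure; rewrite ?inE//.
by move=> t; exact: AB.
Qed.

Lemma lebesgue_rV0 n : lebesgue_rV (set0 : set 'rV[R]_n) = 0%E.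
Proof.
have [mu muE] := @lebesgue_tuple_measure R n.
by rewrite /lebesgue_rV -muE (_ : [set _ | _] = set0) ?measure0//.
Qed.

Lemma lebesgue_rV_dim0 (A : set 'rV[R]_0) : A !=set0 -> lebesgue_rV A = 1%E.
Proof.
move=> [v Av]; rewrite /lebesgue_rV /= /dirac indicE mem_set//=.
by rewrite (_ : \row_i _ = v)//; apply/rowP => -[].
Qed.

Lemma measurable_rV_affine n k (M : 'M[R]_(n, k)) (b : 'rV[R]_k)
    (A : set 'rV[R]_k) :
  measurable_rV A -> measurable_rV [set x | A (x *m M + b)].
Proof.
move=> mA; pose f (t : n.-tuple R) := row_tuple (tuple_row t *m M + b).
have mf : measurable_fun setT f.
  apply/measurable_fun_tnthP => i.
  rewrite (_ : _ \o _ = fun t => \sum_j tnth t j * M j i + b 0 i).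
    apply: measurable_funD => //; apply: measurable_sum => j.
    by apply: measurable_funM => //; exact: measurable_tnth.
  apply/funext => t /=; rewrite tnth_mktuple !mxE; congr (_ + _).
  by apply: eq_bigr => j _; rewrite mxE.
rewrite /measurable_rV (_ : _ @^-1` _ = f @^-1` (@tuple_row R k @^-1` A)).
  by rewrite -[X in measurable X]setTI; exact: mf.
by apply/seteqP; split => t /=; rewrite row_tupleK.
Qed.

Lemma measurable_rV_mulmx n k (M : 'M[R]_(n, k)) (A : set 'rV[R]_k) :
  measurable_rV A -> measurable_rV [set x | A (x *m M)].
Proof.
move=> /(measurable_rV_affine M 0); congr measurable_rV.
by apply/seteqP; split => x /=; rewrite addr0.
Qed.

Definition slice n (A : set 'rV[R]_(1 + n)) (x : R) : set 'rV[R]_n :=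
  [set y | A (row_mx x%:M y)].

Lemma slice_affineE n (A : set 'rV[R]_(1 + n)) (x : R) :
  slice A x = [set y | A (y *m row_mx 0 1%:M + row_mx x%:M 0)].
Proof.
apply/seteqP; split => y; rewrite /slice/= mul_mx_row mulmx0 mulmx1;
  by rewrite add_row_mx add0r addr0.
Qed.

Lemma measurable_slice n (A : set 'rV[R]_(1 + n)) (x : R) :
  measurable_rV A -> measurable_rV (slice A x).
Proof. by rewrite slice_affineE; exact: measurable_rV_affine. Qed.

(** The definition of the product measure, read on row vectors. It holds for
    every set, since that definition is an iterated integral. *)
Lemma lebesgue_rV_slice n (A : set 'rV[R]_(1 + n)) :
  lebesgue_rV A = (\int[@lebesgue_measure R]_x lebesgue_rV (slice A x))%E.
Proof.
rewrite /lebesgue_rV /= /pushforward /product_measure1.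
apply: eq_integral => x _ /=; congr lebesgue_tuple.
have E (t : n.-tuple R) : A (\row_i tnth (cons_tuple x t) i) =
    A (row_mx x%:M (\row_i tnth t i)).
  by rewrite -[\row_i tnth t i]/(tuple_row t) -tuple_row_cons.
by apply/seteqP; split => t; rewrite /xsection /slice /= inE/= E.
Qed.

Lemma measurable_prod_slice n (A : set 'rV[R]_(1 + n)) : measurable_rV A ->
  measurable [set z : measurableTypeR R * n.-tuple R |
    A (row_mx (z.1 : R)%:M (tuple_row z.2))].
Proof.
move=> mA; pose f (z : measurableTypeR R * n.-tuple R) : n.+1.-tuple R :=
  cons_tuple (z.1 : R) z.2.
have mf : measurable_fun setT f.
  exact: (@measurable_cons _ _ _ _ fst n snd).
rewrite (_ : [set _ | _] = f @^-1` (@tuple_row R n.+1 @^-1` A)).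
  by rewrite -[X in measurable X]setTI; exact: mf.
by apply/seteqP; split => z /=; rewrite tuple_row_cons.
Qed.

Lemma measurable_lebesgue_slice n (A : set 'rV[R]_(1 + n)) : measurable_rV A ->
  measurable_fun [set: R] (fun x => lebesgue_rV (slice A x)).
Proof.
move=> /measurable_prod_slice mA.
have [mu muE] := @lebesgue_tuple_measure R n.
have := measurable_fun_xsection mu mA.
congr (measurable_fun _ _); apply/funext => x /=.
rewrite /lebesgue_rV -muE; congr (mu _).
by apply/seteqP; split => t; rewrite /xsection/= inE.
Qed.

(** Tonelli's theorem: the first coordinate is integrated innermost. The outer
    integral is over tuples, on which the sigma-algebra lives. *)
Lemma lebesgue_rV_slice_col n (A : set 'rV[R]_(1 + n))
    (mu : {sigma_finite_measure set (n.-tuple R) -> \bar R}) :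
  (mu : set _ -> \bar R) = @lebesgue_tuple R n -> measurable_rV A ->
  lebesgue_rV A = (\int[mu]_t
     lebesgue_measure [set x : R | A (row_mx x%:M (tuple_row t))])%E.
Proof.
move=> muE /measurable_prod_slice mA.
have := indic_fubini_tonelli (@lebesgue_measure R) mu mA.
rewrite indic_fubini_tonelli_FE//= indic_fubini_tonelli_GE//= => E.
rewrite lebesgue_rV_slice; apply: eq_trans (eq_trans E _).
  apply: eq_integral => x _ /=; rewrite /lebesgue_rV -muE; congr (mu _).
  by apply/seteqP; split => t; rewrite /xsection/= inE.
apply: eq_integral => t _ /=; congr lebesgue_measure.
by apply/seteqP; split => x; rewrite /ysection/= inE.
Qed.

End row_vectors.

(** * Linear change of variables *)

Section change_of_variables.
Context {R : realType}.
Implicit Types n : nat.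
Local Notation leb := (@lebesgue_measure R).

Lemma ge0_integral_slice_affine n (A : set 'rV[R]_(1 + n)) (a b : R) :
  a != 0 -> measurable_rV A ->
  (`|a|%:E * \int[leb]_x lebesgue_rV (slice A (a * x + b)%R) =
   lebesgue_rV A)%E.
Proof.
move=> a0 mA; rewrite lebesgue_rV_slice.
apply: (ge0_integral_affine b a0) => [|x]; last exact: lebesgue_rV_ge0.
exact: measurable_lebesgue_slice.
Qed.

Lemma measurable_rV_translate n (b : 'rV[R]_n) (A : set 'rV[R]_n) :
  measurable_rV A -> measurable_rV [set x | A (x + b)].
Proof.
move=> /(measurable_rV_affine 1%:M b); congr measurable_rV.
by apply/seteqP; split => x /=; rewrite mulmx1.
Qed.

(** The slice at [x] of the translated set is a translate of the slice at
    [x + b_0], so induction handles the last coordinates and translation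
    invariance on the line the first one. *)
Lemma lebesgue_rV_translate n (b : 'rV[R]_n) (A : set 'rV[R]_n) :
  measurable_rV A -> lebesgue_rV [set x | A (x + b)] = lebesgue_rV A.
Proof.
elim: n b A => [|n IH] b A mA.
  congr lebesgue_rV; apply/seteqP; split => x /=;
    by rewrite (_ : x + b = x)//; apply/rowP => -[].
change (measurable_rV (n := 1 + n) A) in mA.
rewrite -(ge0_integral_slice_affine (lsubmx (b : 'rV_(1 + n)) 0 0)
  (oner_neq0 R) mA) normr1 mul1e.
rewrite [LHS]lebesgue_rV_slice; apply: eq_integral => x _.
rewrite -[RHS](IH (rsubmx (b : 'rV_(1 + n))))//; last exact: measurable_slice.
have E (y : 'rV_n) : row_mx x%:M y + b =
    row_mx (1 * x + lsubmx (b : 'rV_(1 + n)) 0 0)%:M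
      (y + rsubmx (b : 'rV_(1 + n))) :> 'rV_(1 + n).
  rewrite -[in LHS](hsubmxK (b : 'rV_(1 + n))) add_row_mx mul1r.
  by rewrite {1}[lsubmx _]mx11_scalar -raddfD.
by congr lebesgue_rV; apply/seteqP; split => y; rewrite /slice/= E.
Qed.

(** Stated on preimages rather than images, so that the set on the left is
    measurable by composition and the property is visibly multiplicative. *)
Definition scales_volume n (M : 'M[R]_n) : Prop :=
  forall A : set 'rV[R]_n, measurable_rV A ->
  (`|\det M|%:E * lebesgue_rV [set x | A (x *m M)] = lebesgue_rV A)%E.

Lemma scales_volume1 n : scales_volume (1%:M : 'M[R]_n).
Proof.
move=> A mA; rewrite det1 normr1 mul1e; congr lebesgue_rV.
by apply/seteqP; split => x /=; rewrite mulmx1.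
Qed.

Lemma scales_volumeM n (M N : 'M[R]_n) :
  scales_volume M -> scales_volume N -> scales_volume (M *m N).
Proof.
move=> PM PN A mA; rewrite -[RHS](PN A mA).
rewrite -(PM [set x | A (x *m N)]); last first.
  exact: measurable_rV_mulmx.
rewrite det_mulmx normrM mulrC EFinM muleA; congr (_%:E * lebesgue_rV _)%E.
by apply/seteqP; split => x /=; rewrite mulmxA.
Qed.

(** The map [(x, y) |-> (a x, x r + y N)] preserves slices: over [x] it is [N]
    followed by a translation. Hence the factor [|det N|] comes from the slices
    and [|a|] from rescaling the outer integral. *)
Lemma scales_volume_ublock n (a : R) (r : 'rV[R]_n) (N : 'M[R]_n) :
  a != 0 -> scales_volume N ->
  scales_volume (block_mx (a%:M) r 0 N : 'M[R]_(1 + n)).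
Proof.
move=> a0 PN A mA; rewrite det_ublock det_scalar expr1 normrM EFinM -muleA.
rewrite -(ge0_integral_slice_affine 0 a0 mA); congr (_%:E * _)%E.
have mS := measurable_rV_mulmx (block_mx (a%:M) r 0 N : 'M[R]_(1 + n)) mA.
rewrite lebesgue_rV_slice -ge0_integralZl//=; last 2 first.
- exact: measurable_lebesgue_slice.
- by move=> x _; exact: lebesgue_rV_ge0.
apply: eq_integral => x _.
have mAx := measurable_slice (a * x + 0) mA.
rewrite -[RHS](lebesgue_rV_translate (x *: r) mAx) -[RHS]PN; last first.
  exact: measurable_rV_translate.
congr (_%:E * lebesgue_rV _)%E; apply/seteqP; split => y; rewrite /slice/=;
  by rewrite mul_row_block mulmx0 addr0 -scalar_mxM mul_scalar_mx
    addr0 (mulrC a) addrC.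
Qed.

(** For fixed [y] the shear [(x, y) |-> (x + y c, y)] is a translation of the
    line, hence the need to integrate over [x] first. *)
Lemma scales_volume_lshear n (c : 'cV[R]_n) :
  scales_volume (block_mx (1%:M) 0 c (1%:M) : 'M[R]_(1 + n)).
Proof.
move=> A mA; rewrite det_lblock !det1 mul1r normr1 mul1e.
have mS := measurable_rV_mulmx (block_mx (1%:M) 0 c (1%:M) : 'M[R]_(1 + n)) mA.
have [mu muE] := @lebesgue_tuple_measure R n.
rewrite !(lebesgue_rV_slice_col muE)//; apply: eq_integral => t _.
pose b := (tuple_row t *m c) 0 0.
have mB : measurable [set x : R | A (row_mx x%:M (tuple_row t))].
  have := measurable_ysection t (measurable_prod_slice mA).
  congr measurable; apply/seteqP; split => x; by rewrite /ysection/= inE.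
rewrite -[RHS](lebesgue_measure_affine b (oner_neq0 R) mB) normr1 mul1e.
congr lebesgue_measure; apply/seteqP; split => x /=;
  by rewrite mul_row_block !mulmx1 mulmx0 add0r mul1r
    [_ *m c]mx11_scalar -/b -raddfD.
Qed.

(** Induction on the dimension by block elimination: a matrix with nonzero top
    left entry is a lower shear times an upper block matrix whose lower right
    block, its Schur complement, is invertible. *)
Lemma scales_volume_unit n (M : 'M[R]_n) : M \in unitmx -> scales_volume M.
Proof.
elim: n M => [|n IH] M uM.
  move=> A mA; rewrite det_mx00 normr1 mul1e; congr lebesgue_rV.
  by apply/seteqP; split => x /=;
    rewrite (_ : x *m M = x)//; apply/rowP => -[].
change ('M[R]_(1 + n)) in M.
have pivot (N : 'M[R]_(1 + n)) : N \in unitmx -> ulsubmx N 0 0 != 0 ->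
    scales_volume N.
  move=> uN; set a := ulsubmx N 0 0 => a0.
  pose r := ursubmx N; pose c := dlsubmx N.
  pose N' := drsubmx N - a^-1 *: (c *m r).
  have NE : N = block_mx 1%:M 0 (a^-1 *: c) 1%:M *m block_mx a%:M r 0 N'.
    rewrite mulmx_block !mul1mx !mul0mx !addr0.
    rewrite -scalemxAl mul_mx_scalar scalerA mulVf// scale1r.
    rewrite -scalemxAl addrC subrK -[LHS]submxK; congr block_mx.
    exact: mx11_scalar.
  rewrite NE; apply: scales_volumeM; first exact: scales_volume_lshear.
  apply: scales_volume_ublock => //; apply: IH.
  move: uN; rewrite NE unitmx_mul => /andP[_].
  by rewrite !unitmxE det_ublock det_scalar expr1 unitrM => /andP[].
have [M00|] := eqVneq (ulsubmx M 0 0) 0; last exact: pivot.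
have [j cj] : exists j, dlsubmx M j 0 != 0.
  apply/existsP; apply: contraLR uM; rewrite negb_exists => /forallP c0.
  have lM0 : lsubmx M = 0.
    apply/matrixP => i k; rewrite ord1 !mxE.
    case: (splitP i) => i' ii'.
      by move: M00; rewrite !mxE; congr (M _ _ = _); apply/val_inj;
        rewrite /= ?ii' ?ord1.
    have := c0 i'; rewrite negbK !mxE => /eqP; congr (M _ _ = _).
    exact/val_inj.
  apply/negP => uM; have := mulmx_lsub (invmx M) M.
  rewrite lM0 mulmx0 mulVmx// => /matrixP/(_ 0 0).
  by rewrite !mxE/= => /eqP; rewrite eq_sym oner_eq0.
(* Adding the row of a nonzero entry of the first column to the first row, an
   upper shear, produces a nonzero pivot. *)
pose E e : 'M[R]_(1 + n) := block_mx 1%:M (e *: delta_mx 0 j) 0 1%:M.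
have uE e : E e \in unitmx by rewrite unitmxE det_ublock !det1 mulr1 unitr1.
have -> : M = E (-1) *m (E 1 *m M).
  rewrite mulmxA mulmx_block !mulmx1 !mul1mx !mulmx0 !addr0 mul0mx.
  by rewrite -scalerDl subrr scale0r add0r -scalar_mx_block mul1mx.
apply: scales_volumeM.
  by apply: scales_volume_ublock; [exact: oner_neq0|exact: scales_volume1].
apply: pivot; first by rewrite unitmx_mul uE.
rewrite -[M]submxK mulmx_block block_mxKul mul1mx mxE M00 add0r scale1r.
by rewrite -rowE mxE.
Qed.

End change_of_variables.

(** * Compact sets are measurable, of finite measure *)

Section compact_sets.
Context {R : realType}.
Implicit Types n k : nat.

Lemma continuous_mx (T : topologicalType) m n (f : T -> 'M[R]_(m, n)) :
  (forall i j, continuous (fun x => f x i j)) -> continuous f.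
Proof.
move=> cf x A [P nP sPA].
have : \forall y \near x, forall ij : 'I_m * 'I_n,
    P ij.1 ij.2 (f y ij.1 ij.2).
  apply: filter_forall => ij; apply: cf; exact: nP.
by apply: filterS => y Py; apply: sPA => i j; exact: (Py (i, j)).
Qed.

Lemma continuous_mulmx n k (M : 'M[R]_(n, k)) :
  continuous (fun x : 'rV[R]_n => x *m M).
Proof.
apply: continuous_mx => i j.
rewrite (_ : (fun _ => _) =
    fun x : 'rV[R]_n => \sum_l x i l * M l j); last first.
  by apply/funext => x; rewrite mxE.
elim: (index_enum _) => [|l s IH].
  under eq_fun do rewrite big_nil; exact: cst_continuous.
under eq_fun do rewrite big_cons.
move=> x; have FF := @nbhs_filter _ x.
apply: (@cvgD R _ _ (nbhs x)); last exact: IH.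
exact/(@cvgMr_tmp R _ (nbhs x))/coord_continuous.
Qed.

(** The norm of row vectors is the sup norm, so an open set is the union of the
    countably many rational cubes that it contains. *)
Lemma open_measurable_rV n (U : set 'rV[R]_n) : open U -> measurable_rV U.
Proof.
move=> oU.
pose box (q : 'rV[rat]_n * nat) : set 'rV[R]_n :=
  [set v | forall i, ball (ratr (q.1 0 i) : R) q.2.+1%:R^-1 (v 0 i)].
have -> : U = \bigcup_(q : 'rV[rat]_n * nat)
    [set v | box q `<=` U /\ box q v].
  apply/seteqP; split=> [v Uv|v [q _ [qU /qU]]//].
  have /nbhs_ballP[e e0 eU] := open_nbhs_nbhs (conj oU Uv).
  (* Cubes of half-side below [e / 2], so that one containing [v] stays in the
     ball of radius [e] around [v]. *)
  pose k := Num.truncn (2 / e).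
  have ke : k.+1%:R^-1 < e / 2 :> R.
    rewrite -[ltRHS]invrK ltf_pV2 ?posrE// ?invr_gt0 ?divr_gt0//.
    by rewrite invf_div truncnS_gt.
  have /choice[q hq] : forall i, exists q : rat,
      ball (ratr q : R) k.+1%:R^-1 (v 0 i).
    move=> i; have : v 0 i - k.+1%:R^-1 < v 0 i + k.+1%:R^-1.
      by rewrite ltrBlDr -addrA ltrDl addr_gt0 ?invr_gt0.
    move=> /rat_in_itvoo[q]; rewrite in_itv/= => hq; exists q.
    by rewrite /ball/= ltr_distl.
  exists (\row_i q i, k) => //; split=> [u bu|i]; last by rewrite /= mxE.
  apply: eU; split => // i j; rewrite ord1 [e]splitr.
  apply: (ball_triangle (y := ratr (q j) : R)).
    by apply/ball_sym/(le_ball (ltW ke)).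
  by apply: (le_ball (ltW ke)); have := bu j; rewrite /= mxE.
rewrite /measurable_rV preimage_bigcup.
apply: countable_bigcupT_measurable => // q.
have [qU|nqU] := pselect (box q `<=` U); last first.
  rewrite (_ : _ @^-1` _ = set0)//.
  by apply/seteqP; split=> // t -[].
rewrite (_ : _ @^-1` _ =
  [set t | forall i, ball (ratr (q.1 0 i) : R) q.2.+1%:R^-1 (tnth t i)]).
  apply: (measurable_tuple_box
    (B := fun i => ball (ratr (q.1 0 i) : R) _)) => i.
  exact: measurable_ball.
apply/seteqP; split => t /=.
  by move=> [_ qt] i; have := qt i; rewrite mxE.
by move=> qt; split => // i; rewrite mxE.
Qed.

Lemma closed_measurable_rV n (A : set 'rV[R]_n) : closed A -> measurable_rV A.
Proof.
move=> cA; rewrite -[A]setCK /measurable_rV preimage_setC.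
apply: measurableC; apply: (@open_measurable_rV _ (~` A)).
exact: closed_openC.
Qed.

Lemma compact_measurable_rV n (K : set 'rV[R]_n) : compact K -> measurable_rV K.
Proof.
move=> cK; apply: closed_measurable_rV.
by apply: compact_closed => //; exact: norm_hausdorff.
Qed.

Lemma compact_lebesgue_rV_fin_num n (K : set 'rV[R]_n) : compact K ->
  lebesgue_rV K \is a fin_num.
Proof.
move=> cK; rewrite ge0_fin_numE; last exact: lebesgue_rV_ge0.
have [M [_ MK]] := compact_bounded cK.
pose r := `|M| + 1.
have r0 : 0 <= r by rewrite addr_ge0.
have Kr v : K v -> forall i, - r <= v 0 i <= r.
  move=> Kv i; rewrite -ler_norml; have := MK r _ v Kv.
  rewrite (le_lt_trans (ler_norm _)) ?ltrDl// => /(_ isT).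
  apply: le_trans; rewrite [leRHS]/Num.Def.normr/= mx_normrE.
  exact: (le_bigmax _ (fun ij => `|v ij.1 ij.2|) (0, i)).
pose B := [set v : 'rV[R]_n | forall i, - r <= v 0 i <= r].
have BE : @tuple_row R n @^-1` B =
    [set t | forall i, - r <= tnth t i <= r].
  by apply/seteqP; split => t /= h i; have := h i; rewrite mxE.
have mB : measurable_rV B.
  by rewrite /measurable_rV BE; exact: measurable_tuple_cube.
apply: (@le_lt_trans _ _ (lebesgue_rV B)).
  by apply: le_lebesgue_rV => //; exact: compact_measurable_rV.
rewrite /lebesgue_rV -[X in lebesgue_tuple X]/(@tuple_row R n @^-1` B) BE.
rewrite lebesgue_tuple_box ?prodEFin ?ltry// => i.
by rewrite (@le_trans _ _ 0)// oppr_le0.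
Qed.

End compact_sets.

(** * Hoelder's inequality with several factors *)

Section hoelder.
Context {R : realType}.

Lemma powR_sum (I : Type) (s : seq I) (p : I -> R) (a : R) : 0 < a ->
  a `^ (\sum_(j <- s) p j) = \prod_(j <- s) a `^ p j.
Proof.
move=> a0; elim: s => [|j s IH]; first by rewrite !big_nil powRr0.
by rewrite !big_cons powRD ?IH// (gt_eqF a0) implybT.
Qed.

Lemma powR_prod (I : Type) (s : seq I) (y : I -> R) (a : R) :
  (forall j, 0 <= y j) ->
  (\prod_(j <- s) y j) `^ a = \prod_(j <- s) y j `^ a.
Proof.
move=> y0; elim: s => [|j s IH]; first by rewrite !big_nil powR1.
by rewrite !big_cons powRM ?IH//; exact: prodr_ge0.
Qed.

(** If the weighted mean [a] is positive, [y_j / a <= exp (y_j / a - 1)]. Raising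
    to the power [p_j] and multiplying over [j], the exponents add up to
    [a / a - 1 = 0]. If [a = 0], some [y_j] of nonzero weight vanishes and the
    product with it. *)
Lemma le_weighted_amgm (I : eqType) (s : seq I) (p y : I -> R) :
  (forall j, 0 <= p j) -> (forall j, 0 <= y j) -> \sum_(j <- s) p j = 1 ->
  \prod_(j <- s) y j `^ p j <= \sum_(j <- s) p j * y j.
Proof.
move=> p0 y0 p1; set a := \sum_(j <- s) p j * y j.
have py0 j : true -> 0 <= p j * y j by move=> _; rewrite mulr_ge0.
have : 0 <= a by exact: sumr_ge0.
rewrite le_eqVlt => /predU1P[a0|a0].
  have [j js pj] : exists2 j, j \in s & p j != 0.
    apply/hasP; apply: contraT; rewrite -all_predC => /allP pz.
    move: p1; rewrite big_seq big1 => [/esym/eqP|j /pz]; last first.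
      by rewrite /= negbK => /eqP.
    by rewrite oner_eq0.
  have yj : y j = 0.
    have : p j * y j = 0.
      apply/eqP; rewrite eq_le py0// andbT a0 /a (big_rem _ js)/= lerDl.
      by apply: sumr_ge0.
    by move=> /eqP; rewrite mulf_eq0 (negbTE pj) => /eqP.
  by rewrite (big_rem _ js)/= yj powR0// mul0r -a0.
have le_exp j : y j `^ p j <= expR (p j * y j / a - p j) * a `^ p j.
  have ya : 0 <= y j / a by rewrite divr_ge0// ltW.
  have -> : p j * y j / a - p j = (y j / a - 1) * p j.
    by rewrite mulrBl mul1r [_ * p j]mulrC mulrA.
  rewrite expRM -powRM ?expR_ge0 ?(ltW a0)//.
  apply: (ge0_ler_powR (p0 j)); rewrite ?nnegrE ?mulr_ge0 ?expR_ge0 ?(ltW a0)//.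
  rewrite -ler_pdivrMr//; apply: le_trans (expR_ge1Dx _).
  by rewrite addrC subrK.
apply: (@le_trans _ _ (\prod_(j <- s) (expR (p j * y j / a - p j) * a `^ p j))).
  by apply: ler_prod => j _; rewrite powR_ge0 le_exp.
rewrite big_split/= -expR_sum sumrB -mulr_suml divff ?gt_eqF// p1 subrr expR0.
by rewrite mul1r -powR_sum// p1 powRr1// ltW.
Qed.

(** Normalize each [g_j] by its integral and integrate the weighted
    arithmetic-geometric mean inequality. Normalization breaks down when an
    integral vanishes, but then [g_j], hence the product, is zero almost
    everywhere. *)
Lemma generalized_hoelder d (T : measurableType d)
    (mu : {measure set T -> \bar R}) (J : eqType) (s : seq J)
    (p : J -> R) (g : J -> T -> R) (c : J -> R) :
  (forall j, 0 <= p j) -> \sum_(j <- s) p j = 1 ->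
  (forall j, measurable_fun setT (g j)) -> (forall j x, 0 <= g j x) ->
  (forall j, \int[mu]_x (g j x)%:E = (c j)%:E)%E ->
  (\int[mu]_x (\prod_(j <- s) g j x `^ p j)%:E <=
   (\prod_(j <- s) c j `^ p j)%:E)%E.
Proof.
move=> p0 p1 mg g0 gc.
have c0 j : 0 <= c j.
  by rewrite -lee_fin -gc; apply: integral_ge0 => x _; rewrite lee_fin.
pose G x := \prod_(j <- s) g j x `^ p j.
have G0 x : 0 <= G x by apply: prodr_ge0 => j _; exact: powR_ge0.
have mG : measurable_fun setT G.
  apply: measurable_prod => j _.
  by apply: (measurableT_comp (measurable_powR _)).
change (\int[mu]_x (G x)%:E <= (\prod_(j <- s) c j `^ p j)%:E)%E.
have [/hasP[j js /andP[pj /eqP cj]]|] :=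
    boolP (has (fun j => (p j != 0) && (c j == 0)) s).
  have gae : ae_eq mu setT (fun x => (g j x)%:E) (cst 0%E).
    apply/(ae_eq_integral_abs mu measurableT); first exact/measurable_EFinP.
    rewrite -[RHS](congr1 EFin cj) -gc.
    by apply: eq_integral => x _; rewrite gee0_abs ?lee_fin.
  rewrite (@ge0_ae_eq_integral _ _ _ mu setT _ (cst 0%E))//.
  - by rewrite integral0 lee_fin; apply: prodr_ge0 => i _; exact: powR_ge0.
  - exact/measurable_EFinP.
  - by move=> x _; rewrite lee_fin.
  - apply: filterS gae => x /(_ I) /= [gx] _.
    by rewrite /G (big_rem _ js)/= gx powR0// mul0r.
rewrite -all_predC => /allP cs.
have {}cs j : j \in s -> p j != 0 -> 0 < c j.
  by move=> /cs /=; rewrite negb_and negbK lt_def c0 andbT => /orP[->|].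
(* Only the factors with [p_j != 0] have to be normalized; the value 1
   elsewhere keeps every [b_j] positive. *)
pose b j := if (p j == 0) || (c j == 0) then 1 else c j.
have b_gt0 j : 0 < b j.
  by rewrite /b; case: ifPn => //; rewrite negb_or lt_def c0 => /andP[_ ->].
have bc j : j \in s -> p j != 0 -> b j = c j.
  by move=> js pj; rewrite /b (negbTE pj) gt_eqF// cs.
pose C := \prod_(j <- s) c j `^ p j.
have C0 : 0 <= C by apply: prodr_ge0 => j _; exact: powR_ge0.
have GC x : G x <= C * \sum_(j <- s) p j * ((b j)^-1 * g j x).
  have -> : G x = C * \prod_(j <- s) ((b j)^-1 * g j x) `^ p j.
    rewrite /G /C -big_split/=; apply: eq_big_seq => j js.
    have [->|pj] := eqVneq (p j) 0; first by rewrite !powRr0 mulr1.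
    rewrite -powRM ?c0 ?mulr_ge0 ?invr_ge0 ?(ltW (b_gt0 j))//.
    by rewrite (bc _ js pj) mulrA divff ?mul1r// gt_eqF// cs.
  apply: ler_wpM2l => //; apply: le_weighted_amgm => // j.
  by rewrite mulr_ge0 ?invr_ge0 ?(ltW (b_gt0 j)).
pose k j := C * p j / b j.
have k0 j : 0 <= k j by rewrite divr_ge0 ?mulr_ge0 ?(ltW (b_gt0 j)).
have mk j : measurable_fun setT (fun x => (k j)%:E * (g j x)%:E)%E.
  by apply: emeasurable_funM => //; exact/measurable_EFinP.
apply: (@le_trans _ _ (\int[mu]_x \sum_(j <- s) ((k j)%:E * (g j x)%:E))%E).
  apply: ge0_le_integral => //.
  - by move=> x _; rewrite lee_fin.
  - exact/measurable_EFinP.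
  - exact: emeasurable_sum.
  - move=> x _; rewrite sumEFin lee_fin (le_trans (GC x))// mulr_sumr.
    by apply: ler_sum => j _; rewrite /k !mulrA.
rewrite ge0_integral_sum//; last first.
  by move=> j x _; rewrite lee_fin mulr_ge0.
have -> : \sum_(j <- s) (\int[mu]_x ((k j)%:E * (g j x)%:E))%E =
    (\sum_(j <- s) (C * p j))%:E.
  rewrite -sumEFin; apply: eq_big_seq => j js.
  have mgj : measurable_fun setT (EFin \o g j) by exact/measurable_EFinP.
  rewrite ge0_integralZl//; last 2 first.
  - by move=> x _; rewrite lee_fin.
  - by rewrite lee_fin.
  rewrite gc -EFinM; congr _%:E; rewrite /k.
  have [->|pj] := eqVneq (p j) 0; first by rewrite mulr0 !mul0r.
  by rewrite (bc _ js pj) mulfVK// gt_eqF// cs.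
by rewrite -mulr_sumr p1 mulr1.
Qed.

End hoelder.

(** * Volumes of coordinate projections *)

Section shearer.
Context {R : realType}.
Implicit Types n k : nat.

(** On compact sets this loses nothing, and it allows real arithmetic and real
    powers. *)
Definition volume n (A : set 'rV[R]_n) : R := fine (lebesgue_rV A).

Lemma volumeK n (K : set 'rV[R]_n) : compact K ->
  lebesgue_rV K = (volume K)%:E.
Proof.
by move=> cK; rewrite /volume fineK//; exact: compact_lebesgue_rV_fin_num.
Qed.

Lemma volume_ge0 n (A : set 'rV[R]_n) : 0 <= volume A.
Proof. exact/fine_ge0/lebesgue_rV_ge0. Qed.

Lemma volume0 n : volume (set0 : set 'rV[R]_n) = 0.
Proof. by rewrite /volume lebesgue_rV0. Qed.

Lemma volume_dim0 (A : set 'rV[R]_0) : A !=set0 -> volume A = 1.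
Proof. by rewrite /volume => /lebesgue_rV_dim0 ->. Qed.

Lemma le_volume n (A B : set 'rV[R]_n) : compact A -> compact B -> A `<=` B ->
  volume A <= volume B.
Proof.
move=> cA cB AB; rewrite -lee_fin -!volumeK//.
by apply: le_lebesgue_rV => //; exact: compact_measurable_rV.
Qed.

Lemma compact_mulmx n k (M : 'M[R]_(n, k)) (K : set 'rV[R]_n) :
  compact K -> compact [set x *m M | x in K].
Proof.
move=> cK; apply: continuous_compact => //.
by apply: continuous_subspaceT; exact: continuous_mulmx.
Qed.

Lemma colsub_mulmx n k (f : 'I_k -> 'I_n) (x : 'rV[R]_n) :
  colsub f x = x *m colsub f 1%:M.
Proof. by rewrite -[x in LHS]mulmx1 mulmx_colsub. Qed.

Lemma compact_colsub n k (f : 'I_k -> 'I_n) (K : set 'rV[R]_n) :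
  compact K -> compact [set colsub f x | x in K].
Proof.
rewrite (_ : [set colsub f x | x in K] = [set x *m colsub f 1%:M | x in K]).
  exact: compact_mulmx.
by apply/seteqP; split => _ [x Kx <-]; exists x; rewrite // colsub_mulmx.
Qed.

(** A slice is the image, under the projection forgetting the first coordinate,
    of the intersection with a closed hyperplane. *)
Lemma compact_slice n (K : set 'rV[R]_(1 + n)) (t : R) :
  compact K -> compact (slice K t).
Proof.
move=> cK; pose c0 (x : 'rV[R]_(1 + n)) := x 0 (lshift n 0).
have -> : slice K t = [set x *m col_mx 0 1%:M | x in K `&` c0 @^-1` [set t]].
  apply/seteqP; split=> [y Ky|_ [x [Kx x0] <-]].
    exists (row_mx t%:M y); last by rewrite mul_row_col mulmx0 mulmx1 add0r.
    by split=> //; rewrite /c0/= row_mxEl mxE.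
  rewrite /slice/= (_ : row_mx _ _ = x)// -[RHS]hsubmxK.
  rewrite -{1}[x]hsubmxK mul_row_col mulmx0 mulmx1 add0r.
  by rewrite [lsubmx x in RHS]mx11_scalar !mxE -x0.
apply: compact_mulmx; apply: compact_closedI => //.
apply: preimage_closed; last exact: closed_eq.
by move=> x _; exact: coord_continuous.
Qed.

(** The projection onto the coordinates in [T] is [colsub f], for [f] the
    increasing enumeration of [T]. Keeping the order makes coordinate 0, if it
    is in [T], the first coordinate of the projection, so that projecting
    commutes with slicing. *)
Definition increasing_inj k n (f : 'I_k -> 'I_n) : Prop :=
  forall a b : 'I_k, (a < b)%N -> (f a < f b)%N.

Lemma colsub_row_mx_lift n k (f : 'I_k -> 'I_(1 + n)) (f' : 'I_k -> 'I_n)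
    (x : 'M[R]_1) (y : 'rV[R]_n) :
  (forall a, f a = lift ord0 (f' a)) -> colsub f (row_mx x y) = colsub f' y.
Proof.
move=> ff'; apply/rowP => a; rewrite mxE ff'.
rewrite (_ : lift ord0 (f' a) = rshift 1 (f' a)) ?row_mxEr ?mxE//.
exact/val_inj.
Qed.

(** One projection in the induction step of [shearer]. Here [f'] enumerates the
    coordinates of [f] other than 0, shifted down by one. If 0 is one of the
    coordinates of [f], projecting the slice of [L] at [t] lands in the slice at
    [t] of the projection of [L], whose volume [g t] integrates to the volume of
    that projection. Otherwise projecting the slice lands in the projection of
    [L] itself, a bound independent of [t], and [g] is 0. *)
Lemma projection_slice n k (f : 'I_k -> 'I_(1 + n)) (L : set 'rV[R]_(1 + n)) :
  compact L -> increasing_inj f ->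
  exists k'f' : {k' & 'I_k' -> 'I_n}, [/\ increasing_inj (projT2 k'f'),
    (forall i, (lift ord0 i \in codom f) = (i \in codom (projT2 k'f'))) &
  exists g : R -> R, [/\ measurable_fun setT g, (forall t, 0 <= g t),
    (\int[@lebesgue_measure R]_t (g t)%:E =
      if ord0 \in codom f then (volume [set colsub f x | x in L])%:E else 0)%E &
    forall t, volume [set colsub (projT2 k'f') y | y in slice L t] <=
      if ord0 \in codom f then g t else volume [set colsub f x | x in L]]].
Proof.
move=> cL incf; have cfL := compact_colsub (f := f) cL.
have [f0|f0] := boolP (ord0 \in codom f); last first.
  have /choice[f' ff'] : forall a, exists b, f a = lift ord0 b.
    move=> a; case: (unliftP ord0 (f a)) => [b ->|fa]; first by exists b.
    by rewrite -fa codom_f in f0.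
  exists (existT _ k f') => /=; split=> [a b ab|i|].
  - by have := incf _ _ ab; rewrite !ff' /= !/bump/= !add1n ltnS.
  - apply/codomP/codomP => -[a]; first by rewrite ff' => /lift_inj ->; exists a.
    by move=> ->; exists a; rewrite ff'.
  exists (fun=> 0); split=> // [|t]; first by rewrite integral0_eq.
  apply: le_volume => //; first exact/compact_colsub/compact_slice.
  move=> _ [y Ly <-]; exists (row_mx t%:M y) => //.
  exact: colsub_row_mx_lift.
case: k f incf cfL f0 => [|k] f incf cfL f0; first by case/codomP: f0 => -[].
have {}f0 : f ord0 = ord0.
  case/codomP: f0 => a fa; have [<-//|a0] := eqVneq a ord0.
  by have := incf ord0 a; rewrite lt0n a0 -fa => /(_ isT).
have fl a : (0 < f (lift ord0 a))%N.
  by have := incf ord0 (lift ord0 a); rewrite f0 => /(_ isT).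
have /choice[f' ff'] : forall a, exists b, f (lift ord0 a) = lift ord0 b.
  move=> a; case: (unliftP ord0 (f (lift ord0 a))) => [b ->|fa].
    by exists b.
  by have := fl a; rewrite fa.
have fE t (y : 'rV_n) : colsub f (row_mx t%:M y) =
    row_mx t%:M (colsub f' y) :> 'rV[R]_(1 + k).
  apply/rowP => a; rewrite mxE; case: (unliftP ord0 a) => [b ->|->].
    rewrite ff' (_ : lift ord0 (f' b) = rshift 1 (f' b)); last exact/val_inj.
    rewrite (_ : lift ord0 b = rshift 1 b); last exact/val_inj.
    by rewrite !row_mxEr mxE.
  rewrite f0 (_ : @ord0 n = @lshift 1 n 0); last exact/val_inj.
  rewrite (_ : @ord0 k = @lshift 1 k 0); last exact/val_inj.
  by rewrite !row_mxEl.
exists (existT _ k f') => /=; split=> [a b ab|i|].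
- have := incf (lift ord0 a) (lift ord0 b).
  by rewrite !ff' /= !/bump/= !add1n !ltnS; exact.
- apply/codomP/codomP => -[a].
    case: (unliftP ord0 a) => [b ->|->]; last by rewrite f0.
    by rewrite ff' => /lift_inj ->; exists b.
  by move=> ->; exists (lift ord0 a); rewrite ff'.
set fL : set 'rV[R]_(1 + k) := [set _ | _ in _] in cfL *.
exists (fun t => volume (slice fL t)); split.
- apply: (measurableT_comp (fine_measurable measurableT)).
  by apply: measurable_lebesgue_slice; apply: compact_measurable_rV; exact: cfL.
- by move=> t; exact: volume_ge0.
- rewrite -volumeK// lebesgue_rV_slice; apply: eq_integral => t _.
  by rewrite -volumeK//; exact: compact_slice.
- move=> t; apply: le_volume; first exact/compact_colsub/compact_slice.
    exact: compact_slice.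
  by move=> _ [y Ly <-]; exists (row_mx t%:M y).
Qed.

(** Finner's weighted form of the Loomis-Whitney inequality. The weights of the
    projections that keep coordinate 0 add up to 1, which is the homogeneity
    required by Hoelder's inequality in the integration over that coordinate. *)
Theorem shearer n m (p : 'I_m -> R) (k : 'I_m -> nat)
    (f : forall j, 'I_(k j) -> 'I_n) (L : set 'rV[R]_n) :
  compact L -> (forall j, increasing_inj (f j)) -> (forall j, 0 <= p j) ->
  (forall i, \sum_j p j * (i \in codom (f j))%:R = 1) ->
  volume L <= \prod_j volume [set colsub (f j) x | x in L] `^ p j.
Proof.
elim: n k f L => [|n IH] k f L cL incf p0 p1.
  have [->|L0] := eqVneq L set0.
    by rewrite volume0; apply: prodr_ge0 => j _; exact: powR_ge0.
  move/set0P in L0; rewrite volume_dim0// big1// => j _.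
  suff -> : volume [set colsub (f j) x | x in L] = 1 by rewrite powR1.
  move: (k j) (f j) => [|k'] f'; last by case: (f' ord0).
  by apply: volume_dim0; case: L0 => x Lx; exists (colsub f' x); exists x.
change (set 'rV[R]_(1 + n)) in L.
have /choice[kf' kf'P] := fun j => projection_slice cL (incf j).
have /choice[g gP] j := let: And3 _ _ h := kf'P j in h.
(* [s] lists the projections that keep coordinate 0; [C] is the constant bound
   for the product over the remaining ones. *)
pose z j := ord0 \in codom (f j).
pose V j := volume [set colsub (f j) x | x in L].
pose s := [seq j <- index_enum 'I_m | z j].
pose C := \prod_(j | ~~ z j) V j `^ p j.
have C0 : 0 <= C by apply: prodr_ge0 => j _; exact: powR_ge0.
have bound t : volume (slice L t) <= C * \prod_(j <- s) g j t `^ p j.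
  apply: (le_trans (IH _ (fun j => projT2 (kf' j)) _ _ _ p0 _)).
  - exact: compact_slice.
  - by move=> j; have [] := kf'P j.
  - move=> i; rewrite -[RHS](p1 (lift ord0 i)); apply: eq_bigr => j _.
    by have [_ ->] := kf'P j.
  rewrite (bigID z)/= mulrC /C big_filter; apply: ler_pM.
  - by apply: prodr_ge0 => j _; exact: powR_ge0.
  - by apply: prodr_ge0 => j _; exact: powR_ge0.
  - apply: ler_prod => j /negbTE zj; rewrite powR_ge0/=.
    apply: (ge0_ler_powR (p0 j)); rewrite ?nnegrE ?volume_ge0//.
    by have [_ _ _ /(_ t)] := gP j; rewrite -/(z j) zj.
  - apply: ler_prod => j zj; rewrite powR_ge0/=.
    have [_ g0 _ /(_ t)] := gP j; rewrite -/(z j) zj => le_g.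
    by apply: (ge0_ler_powR (p0 j)); rewrite ?nnegrE ?volume_ge0.
have mg j : measurable_fun setT (g j) by have [] := gP j.
have g0 j t : 0 <= g j t by have [_ ->] := gP j.
rewrite -lee_fin -volumeK// lebesgue_rV_slice.
have mprod : measurable_fun setT (fun t => \prod_(j <- s) g j t `^ p j).
  apply: measurable_prod => j _.
  exact: (measurableT_comp (measurable_powR _)).
apply: (@le_trans _ _ (\int[@lebesgue_measure R]_t
    (C%:E * (\prod_(j <- s) g j t `^ p j)%:E))%E).
  apply: ge0_le_integral => //.
  - by move=> t _; exact: lebesgue_rV_ge0.
  - by apply: measurable_lebesgue_slice; exact: compact_measurable_rV.
  - exact/measurable_funeM/measurable_EFinP.
  - move=> t _; rewrite volumeK; last exact: compact_slice.
    by rewrite -EFinM lee_fin.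
rewrite ge0_integralZl//; last 2 first.
- exact/measurable_EFinP.
- by move=> t _; rewrite lee_fin; apply: prodr_ge0 => j _; exact: powR_ge0.
rewrite (bigID z)/= mulrC EFinM; apply: lee_wpmul2l; first by rewrite lee_fin.
pose c j := if z j then V j else 0.
have -> : \prod_(j | z j) volume [set colsub (f j) x | x in L] `^ p j =
    \prod_(j <- s) c j `^ p j.
  by rewrite big_filter; apply: eq_bigr => j zj; rewrite /c zj.
apply: generalized_hoelder => //.
  rewrite big_filter -[RHS](p1 ord0) big_mkcond/=; apply: eq_bigr => j _.
  by rewrite -/(z j); case: (z j); rewrite ?mulr1 ?mulr0.
by move=> j; have [_ _ -> _] := gP j; rewrite -/(z j) /c; case: (z j).
Qed.

End shearer.

(** * Measure and orthogonal projection in a subspace *)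

Section subspace_volume.
Context {R : realType} {n : nat}.
Implicit Types (F : 'M[R]_n) (K : set 'rV[R]_n).

Lemma volume_mulmx k (M : 'M[R]_k) (K : set 'rV[R]_k) :
  M \in unitmx -> compact K ->
  volume [set x *m M | x in K] = `|\det M| * volume K.
Proof.
move=> uM cK; have cKM := compact_mulmx (M := M) cK.
apply: EFin_inj; rewrite EFinM -!volumeK//.
rewrite -(scales_volume_unit uM (compact_measurable_rV cKM)).
congr (_ * lebesgue_rV _)%E; apply/seteqP; split => [x [y Ky]|x Kx].
  by move=> /(can_inj (mulmxK uM)) <-.
by exists x.
Qed.

Lemma orthocompE F : orthocomp F = kermx F^T.
Proof. by rewrite /orthocomp /orthomx mul1mx map_mx_id. Qed.

Lemma rank_orthonormal k (B : 'M[R]_(k, n)) : B *m B^T = 1%:M -> \rank B = k.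
Proof. by move=> BB; apply/eqP/row_freeP; exists B^T. Qed.

Lemma orthonormal_id k l (B : 'M[R]_(k, n)) (A : 'M[R]_(l, n)) :
  B *m B^T = 1%:M -> (A <= B)%MS -> A *m B^T *m B = A.
Proof.
by move=> BB /submxP[D ->]; rewrite -2!mulmxA [B *m (_ *m _)]mulmxA BB mul1mx.
Qed.

Lemma det_orthogonal k (U : 'M[R]_k) : U *m U^T = 1%:M -> `|\det U| = 1.
Proof.
move=> UU; apply/eqP; rewrite -sqr_norm_eq1 expr2 -{2}det_tr -det_mulmx UU.
by rewrite det1.
Qed.

(** The measure on a subspace can be computed in any orthonormal basis: two of
    them differ by an orthogonal matrix, which preserves volume. Letting [B]
    have [k] rows avoids casts between equal dimensions. *)
Lemma subspace_measureE k F (B : 'M[R]_(k, n)) A :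
  B *m B^T = 1%:M -> (B == F)%MS -> compact A ->
  subspace_measure F A = lebesgue_rV [set y : 'rV_k | A (y *m B)].
Proof.
move=> BB BF cA.
have kF : k = \rank F by rewrite -(rank_orthonormal BB); exact: eqmx_rank BF.
subst k; have [OO OF] := onbP F; rewrite /subspace_measure.
set O := onb F in OO OF *.
have BO : (B <= O)%MS by rewrite (eqmxP OF) (eqmxP BF).
pose U := B *m O^T.
have UOB : U *m O = B by exact: orthonormal_id.
have UU : U *m U^T = 1%:M.
  by rewrite /U [X in _ *m X]trmx_mul trmxK mulmxA orthonormal_id.
have dU := det_orthogonal UU.
have uU : U \in unitmx by rewrite unitmxE unitfE -normr_eq0 dU oner_eq0.
have mA := measurable_rV_mulmx O (compact_measurable_rV cA).
rewrite -(scales_volume_unit uU mA) dU mul1e; congr lebesgue_rV.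
by apply/seteqP; split => y /=; rewrite -UOB mulmxA.
Qed.

Lemma proj_orthonormal k F (B : 'M[R]_(k, n)) (x : 'rV[R]_n) :
  B *m B^T = 1%:M -> (B == F)%MS ->
  x *m proj_mx F (orthocomp F) = x *m B^T *m B.
Proof.
move=> BB BF; have [dF _] := orthocomp_direct F.
have [/submxP[D FD] _] : (F <= B)%MS /\ (B <= F)%MS by move: BF => /andP[].
have xF : (x *m B^T *m B <= F)%MS by rewrite -(eqmxP BF) submxMl.
have x0 : (x - x *m B^T *m B <= orthocomp F)%MS.
  rewrite orthocompE; apply/sub_kermxP.
  by rewrite FD trmx_mul mulmxA mulmxBl -[_ *m B *m B^T]mulmxA BB mulmx1
    subrr mul0mx.
rewrite -{1}[x](subrK (x *m B^T *m B)) mulmxDl (proj_mx_0 dF x0) add0r.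
exact: proj_mx_id.
Qed.

(** In the coordinates of an orthonormal basis [B], the orthogonal projection is
    [x |-> x B^T]. *)
Lemma subspace_measure_orthoproj k F (B : 'M[R]_(k, n)) K :
  B *m B^T = 1%:M -> (B == F)%MS -> compact K ->
  subspace_measure F (orthoproj F K) = (volume [set x *m B^T | x in K])%:E.
Proof.
move=> BB BF cK; rewrite (subspace_measureE BB BF); last exact: compact_mulmx.
rewrite -volumeK; last exact: compact_mulmx.
congr lebesgue_rV; apply/seteqP; split => [y [x Kx]|_ [x Kx <-]].
  rewrite (proj_orthonormal _ BB BF) => xy; exists x => //.
  by rewrite -[y]mulmx1 -BB mulmxA -xy -[RHS]mulmxA BB mulmx1.
by exists x => //; exact: proj_orthonormal.
Qed.

End subspace_volume.

(** * Parallelepipeds spanned by basis vectors *)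

Section frames.
Context {R : realType} {n : nat}.
Variables (w : 'I_n -> 'rV[R]_n).
Let W : 'M[R]_n := \matrix_i w i.
Implicit Types (T : {set 'I_n}) (k : nat).

(** Indexing a subset by ['I_k], with [k] free rather than equal to [#|T|],
    leaves the dimension of matrices indexed by [T] open to unification. *)
Definition enumerates k (f : 'I_k -> 'I_n) T : Prop :=
  injective f /\ forall i, (i \in T) = (i \in codom f).

Lemma card_enumerates k (f : 'I_k -> 'I_n) T : enumerates f T -> #|T| = k.
Proof.
by move=> [fI fT]; rewrite (eq_card fT) card_codom// card_ord.
Qed.

Lemma sum_enumerates (V : nmodType) k (f : 'I_k -> 'I_n) T (F : 'I_n -> V) :
  enumerates f T -> \sum_(i in T) F i = \sum_a F (f a).
Proof.
move=> [fI fT]; rewrite (eq_bigl (mem (f @: 'I_k))) ?big_imset//=.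
  by move=> a b _ _; exact: fI.
by move=> i; rewrite fT; apply/codomP/imsetP => -[a]; exists a.
Qed.

Lemma spanmx_rowsub k (f : 'I_k -> 'I_n) T : enumerates f T ->
  (rowsub f W == spanmx w T)%MS.
Proof.
move=> [_ fT]; apply/andP; split.
  apply/row_subP => a; rewrite row_rowsub rowK.
  by rewrite (sumsmx_sup (f a)) ?genmxE// fT codom_f.
apply/sumsmx_subP => i; rewrite fT => /codomP[a ->].
by rewrite genmxE -(rowK w) -row_rowsub row_sub.
Qed.

Lemma basis_unitmx : basis_of {: 'rV[R]_n} [seq w i | i : 'I_n] ->
  W \in unitmx.
Proof.
move=> /basis_free wf; have {}wf : free [tuple w i | i < n] by exact: wf.
rewrite -row_free_unit -kermx_eq0; apply/rowV0P => v /sub_kermxP vW.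
apply/rowP => i; rewrite mxE; move/freeP: wf; apply.
rewrite -[RHS]vW mulmx_sum_row; apply: eq_bigr => j _.
by rewrite rowK -tnth_nth tnth_mktuple.
Qed.

Lemma volume_unit_box k :
  volume [set t : 'rV[R]_k | forall a, 0 <= t 0 a <= 1] = 1.
Proof.
rewrite /volume /lebesgue_rV (_ : [set _ | _] =
    [set t : k.-tuple R | forall i, 0 <= tnth t i <= 1]); last first.
  by apply/seteqP; split => t /= h i; have := h i; rewrite mxE.
rewrite (@lebesgue_tuple_box R k (fun=> 0) (fun=> 1))//.
by rewrite big1// => i _; rewrite subr0.
Qed.

Lemma compact_unit_box k :
  compact [set t : 'rV[R]_k | forall a, 0 <= t 0 a <= 1].
Proof.
have := @rV_compact R k (fun=> `[0, 1]%classic)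
  (fun=> @segment_compact R 0 1).
by congr compact; apply/seteqP; split => t /= h a; have := h a;
  rewrite /= in_itv.
Qed.

Lemma parallelepiped_rowsub k (f : 'I_k -> 'I_n) T : enumerates f T ->
  parallelepiped w T =
  [set t *m rowsub f W | t in [set t : 'rV[R]_k | forall a, 0 <= t 0 a <= 1]].
Proof.
move=> fT; have [fI _] := fT.
have sumE (c : 'I_n -> R) :
    \sum_(i in T) c i *: w i = \sum_a c (f a) *: w (f a).
  exact: sum_enumerates.
have mulE (t : 'rV[R]_k) : t *m rowsub f W = \sum_a t 0 a *: w (f a).
  by rewrite mulmx_sum_row; apply: eq_bigr => a _; rewrite row_rowsub rowK.
apply/seteqP; split => [_ [t t01 <-]|_ [t t01 <-]].
  exists (\row_a t (f a)); first by move=> a; rewrite mxE.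
  by rewrite sumE mulE; apply: eq_bigr => a _; rewrite mxE.
(* Outside [T] any value between 0 and 1 would do. *)
pose c i := if [pick a | f a == i] is Some a then t 0 a else 0.
have cf a : c (f a) = t 0 a.
  by rewrite /c; case: pickP => [b /eqP/fI ->//|/(_ a)]; rewrite eqxx.
exists c.
  by move=> i; rewrite /c; case: pickP => // _; rewrite lexx ler01.
by rewrite sumE mulE; apply: eq_bigr => a _; rewrite cf.
Qed.

Hypothesis uW : W \in unitmx.

Lemma rank_rowsub k (f : 'I_k -> 'I_n) : injective f -> \rank (rowsub f W) = k.
Proof.
move=> fI; apply/eqP; rewrite -/(row_free _) -kermx_eq0.
apply/rowV0P => v /sub_kermxP vf.
have : v *m rowsub f 1%:M *m W = 0 by rewrite -mulmxA mul_rowsub_mx mul1mx.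
move=> /(congr1 (mulmx^~ (invmx W))); rewrite mul0mx mulmxK// => v0.
apply/rowP => a; move/rowP/(_ (f a)): v0; rewrite !mxE => <-.
rewrite (bigD1 a)//= !mxE eqxx mulr1 big1 ?addr0// => b ba.
by rewrite !mxE (inj_eq fI) (negbTE ba) mulr0.
Qed.

(** In an orthonormal basis [B] of their span, the vectors [w k], [k in T], have
    coordinate matrix [C = W_T B^T], and their parallelepiped is the image of
    the unit cube under [C]; hence its volume is [|det C|]. *)
Lemma frame_orthonormal k (f : 'I_k -> 'I_n) T : enumerates f T ->
  exists B : 'M[R]_(k, n), [/\ B *m B^T = 1%:M, (B == spanmx w T)%MS,
    rowsub f W = rowsub f W *m B^T *m B, rowsub f W *m B^T \in unitmx &
    wedge_norm w T = `|\det (rowsub f W *m B^T)|].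
Proof.
move=> fT; have [fI _] := fT; have fW := spanmx_rowsub fT.
have rT : \rank (spanmx w T) = k.
  by rewrite -(eqmx_rank fW) rank_rowsub.
have [B [BB BE]] := onb_exists rT.
have fB : rowsub f W *m B^T *m B = rowsub f W.
  by apply: orthonormal_id => //; rewrite (eqmxP BE) -(eqmxP fW).
have uC : rowsub f W *m B^T \in unitmx.
  rewrite -row_free_unit /row_free eqn_leq rank_leq_row/=.
  by rewrite -{1}(rank_rowsub fI) -{1}fB mxrankM_maxl.
exists B; split=> //.
rewrite /wedge_norm rT (card_enumerates fT) eqxx.
rewrite (subspace_measureE BB BE); last first.
  rewrite (parallelepiped_rowsub fT); apply: compact_mulmx.
  exact: compact_unit_box.
rewrite -[RHS]mulr1 -(volume_unit_box k) -volume_mulmx//; last first.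
  exact: compact_unit_box.
rewrite /volume; congr (fine (lebesgue_rV _)).
rewrite (parallelepiped_rowsub fT).
apply/seteqP; split=> [y [t t01 ty]|_ [t t01 <-]].
  by exists t; rewrite // mulmxA ty -mulmxA BB mulmx1.
by exists t; rewrite // -[RHS]mulmxA fB.
Qed.

Lemma wedge_normT : wedge_norm w [set: 'I_n] = `|\det W|.
Proof.
have idT : enumerates id [set: 'I_n].
  by split=> // i; rewrite inE; apply/esym/codomP; exists i.
have [B [BB _ _ _ ->]] := frame_orthonormal idT.
rewrite det_mulmx det_tr normrM (det_orthogonal BB) mulr1.
by congr `|\det _|; apply/matrixP => i j; rewrite mxE.
Qed.

Lemma enumerates_enum_val T :
  enumerates (enum_val : 'I_#|T| -> 'I_n) T.
Proof.
split=> [|i]; first exact: enum_val_inj.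
apply/idP/codomP => [iT|[a ->]]; last exact: enum_valP.
by exists (enum_rank_in iT i); rewrite enum_rankK_in.
Qed.

Lemma increasing_enum_val T : increasing_inj (enum_val : 'I_#|T| -> 'I_n).
Proof.
move=> a b ab; have x0 := enum_val a.
rewrite !(enum_val_nth x0).
have : sorted ltn [seq val i | i <- enum T].
  have : sorted ltn [seq val i | i <- enum 'I_n].
    by rewrite val_enum_ord iota_ltn_sorted.
  have -> : enum T = [seq i <- enum 'I_n | i \in T] by rewrite enumT.
  have tr : transitive (relpre (val : 'I_n -> nat) ltn).
    by move=> x y z /=; exact: ltn_trans.
  by rewrite sorted_map => sorted_n; rewrite sorted_map; exact: sorted_filter.
rewrite sorted_map => /(sorted_ltn_nth _ x0); apply => //.
- by move=> x y z /=; exact: ltn_trans.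
- by rewrite inE -cardE.
- by rewrite inE -cardE.
Qed.

End frames.

(** Typically [C] is an orthonormal basis of the span of the rows indexed by [g]
    and [B] one of its orthogonal complement. In the orthonormal basis [B, C]
    the matrix [W], with its rows listed as [f] then [g], is block upper
    triangular, and neither reordering rows nor an orthogonal change of basis
    affects the absolute determinant. *)
Lemma det_block_split (R : realType) (a b n : nat) (W : 'M[R]_n)
    (f : 'I_a -> 'I_n) (g : 'I_b -> 'I_n)
    (B : 'M[R]_(a, n)) (C : 'M[R]_(b, n)) :
  (a + b = n)%N -> injective f -> injective g -> (forall i j, f i != g j) ->
  B *m B^T = 1%:M -> C *m C^T = 1%:M -> B *m C^T = 0 ->
  rowsub g W *m B^T = 0 ->
  `|\det (rowsub f W *m B^T)| * `|\det (rowsub g W *m C^T)| = `|\det W|.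
Proof.
move=> abn; subst n => fI gI fg BB CC BC gB.
pose h (i : 'I_(a + b)) :=
  match fintype.split i with inl x => f x | inr y => g y end.
have hI : injective h.
  move=> i j; rewrite /h; case: splitP => x ix; case: splitP => y jy.
  - by move/fI => xy; apply/val_inj; rewrite /= ix jy xy.
  - by move=> /eqP; rewrite (negbTE (fg _ _)).
  - by move=> /esym/eqP; rewrite (negbTE (fg _ _)).
  - by move/gI => xy; apply/val_inj; rewrite /= ix jy xy.
have hW : rowsub h W = col_mx (rowsub f W) (rowsub g W).
  by apply/matrixP => i j; rewrite !mxE /h; case: splitP => x _; rewrite mxE.
have dW : `|\det (rowsub h W)| = `|\det W|.
  rewrite (_ : rowsub h W = row_perm (perm hI) W).
    by rewrite row_permE det_mulmx det_perm normrM normr_sign mul1r.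
  by apply/matrixP => i j; rewrite !mxE permE.
have OO : col_mx B C *m (col_mx B C)^T = 1%:M.
  rewrite tr_col_mx mul_col_row BB CC BC -[C *m B^T]trmxK trmx_mul trmxK BC.
  by rewrite trmx0 -scalar_mx_block.
rewrite -dW -[RHS]mulr1 -(det_orthogonal OO).
rewrite -[\det (col_mx _ _)]det_tr -[RHS]normrM.
by rewrite -det_mulmx hW tr_col_mx mul_col_row gB det_ublock normrM.
Qed.

(** * Covers of arbitrary degree *)

Section weighted_shearer.
Context {R : realType} {n m : nat}.

(** For [s > 0] this is [shearer] with the weights [p_j / s]. Let [s <= 0] and
    [L] be nonempty. Since the weights are positive, no projection keeps any
    coordinate, so each factor on the right is 1; and [s < 0] leaves no
    coordinate at all, so the left side is 1 as well. If [L] is empty, [s != 0]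
    makes the left side 0. *)
Lemma shearer_degree (p : 'I_m -> R) (k : 'I_m -> nat)
    (f : forall j, 'I_(k j) -> 'I_n) (L : set 'rV[R]_n) (s : R) :
  compact L -> (forall j, increasing_inj (f j)) -> (forall j, 0 < p j) ->
  (forall i, \sum_j p j * (i \in codom (f j))%:R = s) ->
  L !=set0 \/ s != 0 ->
  volume L `^ s <= \prod_j volume [set colsub (f j) x | x in L] `^ p j.
Proof.
move=> cL incf p0 ps Ls.
have prod_ge0 : 0 <= \prod_j volume [set colsub (f j) x | x in L] `^ p j.
  by apply: prodr_ge0 => j _; exact: powR_ge0.
have [L0|/set0P L0] := eqVneq L set0.
  case: Ls => [[x]|s0]; first by rewrite L0.
  by rewrite (_ : volume L = 0) ?powR0// L0 volume0.
have [s0|s0] := ltP 0 s.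
  have sN0 : s != 0 by rewrite gt_eqF.
  have := @shearer _ _ _ (fun j => p j / s) k f L cL incf.
  have : forall j, 0 <= p j / s by move=> j; rewrite divr_ge0// ltW.
  move=> p0' /(_ p0') sh.
  have {}sh : volume L <=
      \prod_j volume [set colsub (f j) x | x in L] `^ (p j / s).
    apply: sh => i; under eq_bigr do rewrite mulrAC.
    by rewrite -mulr_suml ps divff.
  have := ge0_ler_powR (ltW s0) _ _ sh; rewrite !nnegrE volume_ge0.
  rewrite prodr_ge0 => [|j _]; last exact: powR_ge0.
  move=> /(_ isT isT) /le_trans; apply.
  rewrite powR_prod => [|j]; last exact: powR_ge0.
  rewrite le_eqVlt; apply/orP/or_introl/eqP/eq_bigr => j _.
  by rewrite -powRrM divfK.
have prod1 : \prod_j volume [set colsub (f j) x | x in L] `^ p j = 1.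
  rewrite big1// => j _; suff -> : volume [set colsub (f j) x | x in L] = 1.
    by rewrite powR1.
  have : forall a : 'I_(k j), False.
    move=> a; have := ps (f j a); rewrite (bigD1 j)//= codom_f mulr1 => psE.
    move: s0; rewrite -psE leNgt ltr_wpDr//.
    by apply: sumr_ge0 => i _; rewrite mulr_ge0// ltW.
  move: (k j) (f j) => [|k'] f' absurd; last by case: (absurd ord0).
  by apply: volume_dim0; case: L0 => x Lx; exists (colsub f' x); exists x.
rewrite prod1; move: s0; rewrite le_eqVlt => /predU1P[->|s0].
  by rewrite powRr0.
have n0 : n = 0%N.
  move: (ps); case: (posnP n) => // n_gt0 /(_ (Ordinal n_gt0)) psE.
  move: s0; rewrite -psE ltNge sumr_ge0// => j _.
  by rewrite mulr_ge0// ltW.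
move: L0; clear -n0; subst n => /volume_dim0 ->; by rewrite powR1.
Qed.

End weighted_shearer.

(** * The inequalities in a general basis *)

Section affine_shearer.
Context {R : realType} {n m : nat}.
Context (w : 'I_n -> 'rV[R]_n) (p : 'I_m -> R) (T : 'I_m -> {set 'I_n}).
Context (s : R) (K : set 'rV[R]_n).
Context (uW : \matrix_i w i \in unitmx) (p0 : forall j, 0 < p j).
Context (pT : forall i, \sum_j p j * (i \in T j)%:R = s).
Context (cK : compact K) (Ks : K !=set0 \/ s != 0).
Let W : 'M[R]_n := \matrix_i w i.
Let f j : 'I_#|T j| -> 'I_n := enum_val.
Arguments f : clear implicits.

Let fT j : enumerates (f j) (T j). Proof. exact: enumerates_enum_val. Qed.

Let dW_gt0 : 0 < `|\det W|.
Proof. by rewrite normr_gt0 -unitfE -unitmxE. Qed.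

Let shearer_image (M : 'M[R]_n) : M \in unitmx ->
  (`|\det M| * volume K) `^ s <=
  \prod_j volume [set colsub (f j) (x *m M) | x in K] `^ p j.
Proof.
move=> uM; rewrite -volume_mulmx//.
rewrite (eq_bigr (fun j => volume [set colsub (f j) x |
    x in [set x *m M | x in K]] `^ p j)) => [|j _]; last first.
  by rewrite image_comp.
apply: shearer_degree => //.
- exact: compact_mulmx.
- by move=> j; exact: increasing_enum_val.
- move=> i; rewrite -(pT i); apply: eq_bigr => j _.
  by case: (fT j) => _ ->.
- case: Ks => [[x Kx]|]; last by right.
  by left; exists (x *m M); exists x.
Qed.

(** Pulls the factors [a_j] and [c], by which a linear image changes the volumes
    of the projections of [K] and of [K] itself, out of the powers. *)
Let shearer_conclude (F : 'I_m -> 'M[R]_n) (V a : 'I_m -> R) (c d : R) :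
  0 < c -> (forall j, 0 <= V j) -> (forall j, 0 <= a j) ->
  (forall j, subspace_measure (F j) (orthoproj (F j) K) = (V j)%:E) ->
  (c * volume K) `^ s <= d * \prod_j (a j * V j) `^ p j ->
  (lebesgue_rV K `^ s <=
   (d * (\prod_j a j `^ p j) / c `^ s)%:E *
   \prod_j subspace_measure (F j) (orthoproj (F j) K) `^ p j)%E.
Proof.
move=> c0 V0 a0 FV.
under [in X in _ <= X -> _]eq_bigr do rewrite powRM//.
rewrite big_split/= powRM ?(ltW c0) ?volume_ge0// => le_cK.
under [X in (_ * X)%E]eq_bigr do rewrite FV poweR_EFin.
rewrite prodEFin volumeK// poweR_EFin -EFinM lee_fin mulrAC.
by rewrite ler_pdivlMr ?powR_gt0// mulrC -mulrA.
Qed.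

(** [shearer] for the image of [K] under [W^T], whose coordinates are the inner
    products with the [w k]: those with [k in T_j] depend only on the projection
    onto the span of these [w k], through the matrix of [frame_orthonormal]. *)
Lemma affine_shearer_span :
  (lebesgue_rV K `^ s <=
  (\prod_j wedge_norm w (T j) `^ p j / `|\det W| `^ s)%:E *
  \prod_j subspace_measure (spanmx w (T j)) (orthoproj (spanmx w (T j)) K)
    `^ p j)%E.
Proof.
have uWT : W^T \in unitmx by rewrite unitmx_tr.
have := shearer_image uWT; rewrite det_tr.
have /choice[V VP] : forall j, exists V : R, [/\ 0 <= V,
    subspace_measure (spanmx w (T j)) (orthoproj (spanmx w (T j)) K) = V%:E,
    0 <= wedge_norm w (T j) &
    volume [set colsub (f j) (x *m W^T) | x in K] = wedge_norm w (T j) * V].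
  move=> j; have [B [BB BE fB uC ->]] := frame_orthonormal uW (fT j).
  exists (volume [set x *m B^T | x in K]); split => //.
  - exact: volume_ge0.
  - exact: subspace_measure_orthoproj.
  rewrite -det_tr -volume_mulmx ?unitmx_tr//; last exact: compact_mulmx.
  congr volume; rewrite image_comp; apply: eq_imagel => x _ /=.
  rewrite -mulmxA -trmx_mul -fB; apply/matrixP => a b.
  by rewrite !mxE; apply: eq_bigr => c _; rewrite !mxE.
rewrite (eq_bigr (fun j => (wedge_norm w (T j) * V j) `^ p j)) => [sh|j _];
  last by have [_ _ _ ->] := VP j.
rewrite -[X in X / _]mul1r.
apply: (@shearer_conclude _ V) => //; last by rewrite mul1r.
- by move=> j; have [] := VP j.
- by move=> j; have [] := VP j.
- by move=> j; have [] := VP j.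
Qed.

(** [shearer] for the image of [K] under [W^-1], whose coordinates are those in
    the basis [w]: projecting onto the orthogonal complement of
    [span (w k : k notin T_j)] keeps the coordinates in [T_j] only, through a
    matrix whose determinant is given by [det_block_split]. *)
Lemma affine_shearer_orthocomp :
  (lebesgue_rV K `^ s <=
  (\prod_j wedge_norm w (~: T j) `^ p j / `|\det W| `^ (\sum_j p j - s))%:E *
  \prod_j subspace_measure (orthocomp (spanmx w (~: T j)))
    (orthoproj (orthocomp (spanmx w (~: T j))) K) `^ p j)%E.
Proof.
pose F j := orthocomp (spanmx w (~: T j)).
have uWV : invmx W \in unitmx by rewrite unitmx_inv.
have := shearer_image uWV; rewrite det_inv normfV.
have /choice[V VP] : forall j, exists V : R, [/\ 0 <= V,
    subspace_measure (F j) (orthoproj (F j) K) = V%:E,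
    0 <= wedge_norm w (~: T j) &
    volume [set colsub (f j) (x *m invmx W) | x in K] =
      `|\det W|^-1 * (wedge_norm w (~: T j) * V)].
  move=> j; pose g : 'I_#|~: T j| -> 'I_n := enum_val.
  have gT : enumerates g (~: T j) by exact: enumerates_enum_val.
  have [C [CC CE _ _ wC]] := frame_orthonormal uW gT.
  have rF : \rank (F j) = #|T j|.
    rewrite /F orthocompE mxrank_ker mxrank_tr.
    have -> : \rank (spanmx w (~: T j)) = #|~: T j|.
      by rewrite -(eqmx_rank CE) rank_orthonormal.
    by rewrite -[X in (X - _)%N]card_ord -(cardsC (T j)) addnK.
  have [B [BB BE]] := onb_exists rF.
  have B0 k (A : 'M[R]_(k, n)) : (A <= spanmx w (~: T j))%MS -> A *m B^T = 0.
    move=> /submxP[D ->]; rewrite -mulmxA (_ : _ *m B^T = 0) ?mulmx0//.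
    apply: trmx_inj; rewrite trmx_mul trmxK trmx0; apply/sub_kermxP.
    by rewrite -orthocompE; move: BE => /andP[].
  have gB : rowsub g W *m B^T = 0.
    by apply: B0; rewrite (eqmxP (spanmx_rowsub w gT)).
  have BC : B *m C^T = 0.
    apply: trmx_inj; rewrite trmx_mul trmxK trmx0; apply: B0.
    by move: CE => /andP[].
  have split_det : `|\det (rowsub (f j) W *m B^T)| * wedge_norm w (~: T j) =
      `|\det W|.
    rewrite wC; apply: det_block_split => //.
    - by rewrite cardsC card_ord.
    - exact: enum_val_inj.
    - exact: enum_val_inj.
    - move=> a b; apply: contraTneq (enum_valP b) => fg.
      by rewrite inE negbK -[enum_val b]/(g b) -fg; exact: enum_valP.
  set A := rowsub (f j) W *m B^T in split_det.
  have uA : A \in unitmx.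
    rewrite unitmxE unitfE -normr_eq0; apply: contraTneq dW_gt0 => A0.
    by rewrite -split_det A0 mul0r ltxx.
  (* Expand [x] in the basis [w]: the vectors outside [T_j] are killed. *)
  have gE (x : 'rV[R]_n) : x *m B^T = colsub (f j) (x *m invmx W) *m A.
    have -> : A = rowsub (f j) (W *m B^T) by rewrite /A mul_rowsub_mx.
    rewrite -{1}[x](mulmxKV uW) -/W -[_ *m W *m _]mulmxA.
    move: (x *m invmx W) => y; apply/rowP => c; rewrite mxE [RHS]mxE.
    rewrite (bigID (mem (T j)))/= [X in _ + X]big1 ?addr0 => [|i iT].
      rewrite (sum_enumerates _ (fT j)).
      by apply: eq_bigr => a _; congr (_ * _); rewrite [RHS]mxE.
    have : w i *m B^T = 0.
      by apply: B0; rewrite /spanmx (sumsmx_sup i) ?genmxE// inE.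
    by rewrite -(rowK w) -row_mul => /rowP/(_ c); rewrite mxE => ->;
      rewrite mxE mulr0.
  exists (volume [set x *m B^T | x in K]); split.
  - exact: volume_ge0.
  - exact: subspace_measure_orthoproj.
  - by rewrite wC.
  have -> : [set x *m B^T | x in K] =
      [set y *m A | y in [set colsub (f j) (x *m invmx W) | x in K]].
    by rewrite image_comp; apply: eq_imagel => x _ /=.
  rewrite volume_mulmx//; last first.
    rewrite -(image_comp (fun x : 'rV_n => x *m invmx W)).
    exact/compact_colsub/compact_mulmx.
  rewrite (mulrA (wedge_norm _ _)) [wedge_norm _ _ * _]mulrC split_det.
  by rewrite mulKf// gt_eqF.
rewrite (eq_bigr (fun j => `|\det W|^-1 `^ p j *
    (wedge_norm w (~: T j) * V j) `^ p j)) => [|j _]; last first.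
  have [V0 _ w0 ->] := VP j.
  by rewrite [LHS]powRM ?invr_ge0 ?mulr_ge0 ?(ltW dW_gt0).
rewrite big_split/= -powR_sum ?invr_gt0// => sh.
pose q := \sum_j p j.
have -> : (\prod_j wedge_norm w (~: T j) `^ p j) / `|\det W| `^ (q - s) =
    `|\det W|^-1 `^ q * (\prod_j wedge_norm w (~: T j) `^ p j) /
      `|\det W|^-1 `^ s.
  have invE t : `|\det W|^-1 `^ t = (`|\det W| `^ t)^-1.
    by rewrite -(powR_inv1 (ltW dW_gt0)) -powRrM mulN1r powRN.
  rewrite !invE powRB ?(gt_eqF dW_gt0) ?implybT// invfM !invrK mulrA.
  by rewrite [_ * (_ `^ q)^-1]mulrC.
apply: (@shearer_conclude F V) => //; first by rewrite invr_gt0.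
- by move=> j; have [] := VP j.
- by move=> j; have [] := VP j.
- by move=> j; have [] := VP j.
Qed.

End affine_shearer.

(* The second and fourth inequalities read 0 ^ 0 on the left exactly when K   *)
(* is empty and the total weight is 1; that case is left out.                 *)
Theorem theorem1p4 (R : realType) (n m : nat)
    (w : 'I_n -> 'rV[R]_n) (S : 'I_m -> {set 'I_n}) (p : 'I_m -> R)
    (m_gt0 : (0 < m)%N)
    (w_basis : basis_of {: 'rV[R]_n} [seq w i | i : 'I_n])
    (S_cover : uniform_cover S p) (K : set 'rV[R]_n) (K_compact : compact K) :
  let H j := spanmx w (S j) in
  let Htilde j := spanmx w (~: S j) in
  let q := \sum_(j < m) p j in
  [/\ (lebesgue_rV K <=
        (BL1 w S p)%:E * \prod_(j < m)
          subspace_measure (orthocomp (Htilde j))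
            (orthoproj (orthocomp (Htilde j)) K) `^ p j)%E,
      K !=set0 \/ q != 1 ->
      (lebesgue_rV K `^ (q - 1) <=
        (BL2 w S p)%:E * \prod_(j < m)
          subspace_measure (orthocomp (H j))
            (orthoproj (orthocomp (H j)) K) `^ p j)%E,
      (lebesgue_rV K <=
        (BL2 w S p)%:E * \prod_(j < m)
          subspace_measure (H j) (orthoproj (H j) K) `^ p j)%E &
      K !=set0 \/ q != 1 ->
      (lebesgue_rV K `^ (q - 1) <=
        (BL1 w S p)%:E * \prod_(j < m)
          subspace_measure (Htilde j) (orthoproj (Htilde j) K) `^ p j)%E].
Proof.
move=> H Ht q; have [p0 p1] := S_cover.
have uW := basis_unitmx w_basis.
(* The complements cover every index with total weight [q - 1]. *)
have pC i : \sum_j p j * (i \in ~: S j)%:R = q - 1.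
  rewrite -[X in q - X](p1 i) /q -sumrB; apply: eq_bigr => j _.
  by rewrite inE; case: (i \in S j); rewrite ?mulr1 ?mulr0 ?subrr ?subr0.
have one0 : K !=set0 \/ (1 : R) != 0 by right; exact: oner_neq0.
have K1 : (lebesgue_rV K `^ 1 = lebesgue_rV K)%E.
  by rewrite volumeK// poweR_EFin powRr1// volume_ge0.
have q10 : K !=set0 \/ q != 1 -> K !=set0 \/ q - 1 != 0.
  by rewrite subr_eq0.
have wT := wedge_normT uW.
have w1 : wedge_norm w [set: 'I_n] `^ 1 = wedge_norm w [set: 'I_n].
  by rewrite powRr1// wT normr_ge0.
split=> [|/q10 Kq||/q10 Kq].
- have := affine_shearer_orthocomp uW p0 p1 K_compact one0.
  by rewrite K1 -wT.
- have SCC : S = fun j => ~: ~: S j by apply/funext => j; rewrite finset.setCK.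
  have := affine_shearer_orthocomp uW p0 pC K_compact Kq.
  by rewrite subKr -wT w1 /H /BL2 [in X in _ -> X]SCC.
- have := affine_shearer_span uW p0 p1 K_compact one0.
  by rewrite K1 -wT w1.
- have := affine_shearer_span uW p0 pC K_compact Kq.
  by rewrite -wT.
Qed.
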